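(* Let $V_i:\mathbb R\to\mathbb R_+$, $i\in\mathbb N$, and $\bar V:\mathbb R\to\mathbb R_+$ be superquadratic Orlicz functions which are uniformly superquadratic in the sense that there is a constant $c_V\in(0,\infty)$ such that for all $x>c_V$, $V_i(x)>x^2$ for every $i\in\mathbb N$ and $\bar V(x)>x^2$. Let $$\mathbb B^n_{V_1,\dots,V_n}=\Big\{x\in\mathbb R^n:\sum_{i=1}^nV_i(x_i)\le n\Big\},\qquad\mathbb B^n_{\bar V}=\Big\{x\in\mathbb R^n:\sum_{i=1}^n\bar V(x_i)\le n\Big\},$$ and suppose that, as $n\to\infty$, $$\frac1n\log\frac{|\mathbb B^n_{\bar V}\,\Delta\,\mathbb B^n_{V_1,\dots,V_n}|}{|\mathbb B^n_{\bar V}\cup\mathbb B^n_{V_1,\dots,V_n}|}\to-\infty,$$ where $|\cdot|$ is Lebesgue volume and $\Delta$ is symmetric difference. Let $X^{(n)}$ be uniformly distributed on $\mathbb B^n_{V_1,\dots,V_n}$. Then $\{\|X^{(n)}\|_2/\sqrt n\}_{n\in\mathbb N}$ satisfies an LDP at speed $n$ with GRF $$J_{X,\bar V}(z)=\mathcal J_{\bar V}(1,z^2)-\sup_{s<0}\left\{s-\log\left(\int_{\mathbb R}e^{s\bar V(x)}dx\right)\right\},\qquad z\in\mathbb R_+=[0,\infty).$$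
   Context: An Orlicz function is a convex even function $V$ on $\mathbb R$ with values in $[0,\infty]$ and $V(0)=0$; it is superquadratic if $V(x)/x^2\to\infty$ as $x\to\infty$. For $u,v\in\mathbb R_+$, $\mathcal J_{\bar V}(u,v)=\sup_{s<0,\,t\in\mathbb R}\left\{su+tv-\log\left(\int_{\mathbb R}e^{s\bar V(x)+tx^2}dx\right)\right\}$. LDP: a sequence of random variables $\{\eta_n\}$ with values in a regular topological space $\mathcal X$ satisfies a large deviation principle (LDP) at speed $s_n$ (positive reals with $s_n\to\infty$) with rate function $I:\mathcal X\to[0,\infty]$ if $I$ is lower semicontinuous and for every Borel set $\Gamma$, $-\inf_{\Gamma^\circ}I\le\liminf_n\frac1{s_n}\log\mathbb P(\eta_n\in\Gamma)\le\limsup_n\frac1{s_n}\log\mathbb P(\eta_n\in\Gamma)\le-\inf_{\bar\Gamma}I$. It is a good rate function (GRF) if moreover its level sets are compact. *)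

(* Defs.v *)
Set Warnings "-notation-overridden,-ambiguous-paths,-notation-incompatible-prefix,-redundant-canonical-projection".
From HB Require Import structures.
From mathcomp Require Import all_boot all_order all_algebra.
From mathcomp Require Import all_classical all_reals all_analysis.

Set Implicit Arguments.
Unset Strict Implicit.
Unset Printing Implicit Defensive.

Import Order.TTheory GRing.Theory Num.Theory.
Import numFieldTopology.Exports numFieldNormedType.Exports.

Local Open Scope classical_set_scope.
Local Open Scope ring_scope.
Local Open Scope ereal_scope.

Notation Rn R n := (n.-tuple (measurableTypeR R)).

Section lebesgue_step.
Context (R : realType) (n : nat).
Variable mu : {sigma_finite_measure set (Rn R n) -> \bar R}.

Let glue (p : measurableTypeR R * Rn R n) : Rn R n.+1 :=
  [the n.+1.-tuple _ of p.1 :: p.2].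

Let measurable_glue : measurable_fun [set: _] glue.
Proof. exact: measurable_cons. Qed.

(* The image of [lebesgue_measure \x mu] under R * R^n -> R^(n+1). *)
Definition lebesgue_step : set (Rn R n.+1) -> \bar R :=
  pushforward (lebesgue_measure \x mu) glue.

Let lebesgue_step0 : lebesgue_step set0 = 0.
Proof. by rewrite /lebesgue_step /pushforward preimage_set0 measure0. Qed.

Let lebesgue_step_ge0 A : 0 <= lebesgue_step A.
Proof. exact: measure_ge0. Qed.

Let lebesgue_step_sigma_additive : semi_sigma_additive lebesgue_step.
Proof.
move=> F mF tF mUF; rewrite /lebesgue_step /pushforward preimage_bigcup.
apply: measure_semi_sigma_additive.
- by move=> k; rewrite -[X in measurable X]setTI; exact: measurable_glue.
- apply/trivIsetP => /= i j _ _ ij; rewrite -preimage_setI.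
  by move/trivIsetP : tF => /(_ _ _ _ _ ij) ->//; rewrite preimage_set0.
- by rewrite -preimage_bigcup -[X in measurable X]setTI; exact: measurable_glue.
Qed.

HB.instance Definition _ := isMeasure.Build _ _ _ lebesgue_step
  lebesgue_step0 lebesgue_step_ge0 lebesgue_step_sigma_additive.

Let lebesgue_step_sigma_finite : sigma_finite setT lebesgue_step.
Proof.
have /sigma_finiteP[F [FT ndF Foo]] := sigma_finiteT (@lebesgue_measure R).
have /sigma_finiteP[G [GT ndG Goo]] := sigma_finiteT mu.
pose unglue (x : Rn R n.+1) : measurableTypeR R * Rn R n :=
  (tnth x ord0, [tuple of behead x]).
have munglue : measurable_fun [set: _] unglue.
  apply/measurable_fun_pairP; split; first exact: measurable_tnth.
  exact: measurable_behead.
have glueK p : unglue (glue p) = p.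
  by case: p => a b; rewrite /unglue /glue /=; congr (_, _); exact/val_inj.
exists (fun k => unglue @^-1` (F k `*` G k)).
  rewrite -preimage_bigcup; apply/esym; rewrite -subTset => x _ /=.
  have [i _ Fi] : (\bigcup_k F k) (unglue x).1 by rewrite -FT.
  have [j _ Gj] : (\bigcup_k G k) (unglue x).2 by rewrite -GT.
  exists (maxn i j) => //; split.
  - by move: Fi; exact/subsetPset/ndF/leq_maxl.
  - by move: Gj; exact/subsetPset/ndG/leq_maxr.
move=> k; have [mFk Fkoo] := Foo k; have [mGk Gkoo] := Goo k; split.
  rewrite -[X in measurable X]setTI; apply: munglue => //.
  exact: measurableX.
rewrite /lebesgue_step /pushforward -comp_preimage.
rewrite (_ : unglue \o glue = id) ?preimage_id; last exact/funext.
by rewrite product_measure1E// lte_mul_pinfty// ge0_fin_numE.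
Qed.

HB.instance Definition _ := Measure_isSigmaFinite.Build _ _ _
  lebesgue_step lebesgue_step_sigma_finite.

End lebesgue_step.

Fixpoint lebesgue_n (R : realType) (n : nat) :
    {sigma_finite_measure set (Rn R n) -> \bar R} :=
  match n with
  | 0%N => \d_([tuple] : Rn R 0)
  | m.+1 => lebesgue_step (lebesgue_n R m)
  end.

Section orlicz.
Context (R : realType).
Implicit Type V : R -> \bar R.

Definition orlicz V : Prop :=
  [/\ forall (t x y : R), (0 <= t <= 1)%R ->
        V ((1 - t) * x + t * y)%R <= (1 - t)%:E * V x + t%:E * V y,
      forall x, V (- x)%R = V x,
      forall x, 0 <= V x &
      V 0%R = 0].

Definition superquadratic V : Prop :=
  V x / (x ^+ 2)%:E @[x --> +oo%R] --> +oo.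

End orlicz.

Section large_deviations.
Context (R : realType) (X : topologicalType).
Implicit Type I : X -> \bar R.

Definition borel : set (set X) := <<s open >>.

Definition rate_function I : Prop :=
  (forall x, 0 <= I x) /\ lower_semicontinuous I.

Definition good_rate_function I : Prop :=
  rate_function I /\ forall a : R, compact [set x | I x <= a%:E].

(* The variables [eta n] need not live on a common probability space. *)
Definition LDP (d : nat -> measure_display)
    (T : forall n, measurableType (d n)) (P : forall n, probability (T n) R)
    (eta : forall n, T n -> X) (s : nat -> R) (I : X -> \bar R) : Prop :=
  [/\ regular_space X,
      forall n G, borel G -> measurable (eta n @^-1` G),
      (forall n, 0 < s n)%R /\ s n @[n --> \oo] --> +oo%R,
      rate_function I &
      forall G, borel G ->
        let u n := ((s n)^-1)%:E * lne (P n (eta n @^-1` G)) in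
        [/\ - ereal_inf (I @` G°) <= limn_einf u,
            limn_einf u <= limn_esup u &
            limn_esup u <= - ereal_inf (I @` closure G)]].

End large_deviations.

Section orlicz_balls.
Context (R : realType).

(* Coordinates are numbered from 0: [V i] is the function acting on the
   coordinate [i : 'I_n]. *)
Definition orlicz_ball (n : nat) (V : nat -> R -> R) : set (Rn R n) :=
  [set x | (\sum_(i < n) V i (tnth x i) <= n%:R)%R].

Definition uniform_on d (T : measurableType d) (P : probability T R) (n : nat)
    (X : {RV P >-> Rn R n}) (B : set (Rn R n)) : Prop :=
  forall A, measurable A ->
    P (X @^-1` A) = lebesgue_n R n (A `&` B) / lebesgue_n R n B.

Definition l2norm (n : nat) (x : Rn R n) : R :=
  Num.sqrt (\sum_(i < n) (tnth x i : R) ^+ 2)%R.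

Definition Rplus : set R := `[0%R, +oo[%classic.

Lemma l2norm_div_sqrt_Rplus n (x : Rn R n) :
  (l2norm x / Num.sqrt n%:R)%R \in Rplus.
Proof. by rewrite inE /Rplus /= in_itv/= andbT divr_ge0 ?sqrtr_ge0. Qed.

(* [set_type Rplus] carries the topology induced by [R]. *)
Definition scaled_norm (n : nat) (x : Rn R n) : set_type Rplus :=
  exist _ (l2norm x / Num.sqrt n%:R)%R (l2norm_div_sqrt_Rplus x).

Definition calJ (V : R -> R) (u v : R) : \bar R :=
  ereal_sup [set (s * u + t * v)%:E -
      lne (\int[lebesgue_measure]_x (expR (s * V x + t * x ^+ 2))%:E)
    | s in [set s : R | (s < 0)%R] & t in [set: R]].

Definition JX (V : R -> R) (z : set_type Rplus) : \bar R :=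
  calJ V 1 (set_val z ^+ 2) -
  ereal_sup [set s%:E - lne (\int[lebesgue_measure]_x (expR (s * V x))%:E)
    | s in [set s : R | (s < 0)%R]].

End orlicz_balls.

Arguments orlicz_ball {R} n V.

(* Main.v *)
(* Idea.  Let L(s,t) = log int e^(s Vbar + t x^2), finite exactly where it is
   needed, namely for s < 0.  Exponential Chebyshev bounds the volume of
   {sum Vbar(x_i) <= n, sum x_i^2 = n v} by e^(-n (s + t v - L(s,t))) for every
   s < 0 and t, which with a finite subcover gives the upper bound on closed
   sets.  For the lower bound one tilts Lebesgue measure by
   e^(s Vbar + t x^2) at an approximate minimiser (s,t) of
   L(s,t) - s u - t v plus a small penalty with a logarithmic barrier at s = 0.
   No derivative of L is taken: a bound on its second differences turns
   "moving in direction -q does not decrease the penalised function" into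
   "the tilted mass of large deviations in direction +q is exponentially
   small".  Four directions suffice, because sum Vbar(x_i) only has to be
   bounded from above.  Volumes of Vbar-balls are the case where x^2 is replaced
   by 0, and the superexponential closeness of the two families of balls
   transfers everything to the uniform law. *)
Require Import Defs.
From mathcomp Require Import all_boot all_order all_algebra.
From mathcomp Require Import all_classical all_reals all_analysis.
From mathcomp Require Import measurable_realfun ring lra.

Set Implicit Arguments.
Unset Strict Implicit.
Unset Printing Implicit Defensive.

Import Order.TTheory GRing.Theory Num.Theory.
Import numFieldTopology.Exports numFieldNormedType.Exports.

Local Open Scope classical_set_scope.
Local Open Scope ring_scope.
Local Open Scope ereal_scope.

(** * Exponential integrals on R^n *)

Section lebesgue_n_integral.
Context (R : realType).
Implicit Types (phi : R -> R) (n : nat).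

Lemma measurable_sum_tnth n phi : measurable_fun setT phi ->
  measurable_fun setT (fun x : Rn R n => (\sum_(i < n) phi (tnth x i))%R).
Proof.
move=> mphi; apply: measurable_sum => i.
by apply: (measurableT_comp mphi); exact: measurable_tnth.
Qed.

Lemma measurable_prod_tnth n phi : measurable_fun setT phi ->
  measurable_fun setT (fun x : Rn R n => (\prod_(i < n) phi (tnth x i))%R).
Proof.
move=> mphi; apply: measurable_prod => i _.
by apply: (measurableT_comp mphi); exact: measurable_tnth.
Qed.

(** Induction on the dimension: Tonelli splits off the first coordinate. In dimension 0 the measure
    is a Dirac mass, so the empty product integrates to 1. *)
Lemma integral_lebesgue_n_prod n phi (z : R) :
  measurable_fun setT phi -> (forall x, 0 <= phi x)%R ->
  \int[lebesgue_measure]_x (phi x)%:E = z%:E ->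
  \int[lebesgue_n R n]_x (\prod_(i < n) phi (tnth x i))%:E = (z ^+ n)%:E.
Proof.
move=> mphi phi0 phiz; elim: n => [|n ih].
  rewrite integral_dirac//; last first.
    by apply/measurable_EFinP; exact: measurable_prod_tnth.
  by rewrite diracT mul1e big_ord0 expr0.
have mcons : measurable_fun setT (fun p : measurableTypeR R * Rn R n =>
  [the n.+1.-tuple _ of p.1 :: p.2]) by exact: measurable_cons.
rewrite /= /lebesgue_step (ge0_integral_pushforward mcons)//=; first last.
- by move=> x _; rewrite lee_fin prodr_ge0.
- by apply/measurable_EFinP; exact: measurable_prod_tnth.
rewrite preimage_setT.
have -> : \int[lebesgue_measure \x lebesgue_n R n]_p
    (\prod_(i < n.+1) phi (tnth [the n.+1.-tuple _ of p.1 :: p.2] i))%:E =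
  \int[lebesgue_measure \x lebesgue_n R n]_p
    ((phi p.1)%:E * (\prod_(i < n) phi (tnth p.2 i))%:E).
  apply: eq_integral => p _; rewrite -EFinM big_ord_recl/=; congr (_ * _)%:E.
  by apply: eq_bigr => i _; rewrite !(tnth_nth 0%R).
rewrite fubini_tonelli1//=; first last.
- by move=> x; rewrite mule_ge0 ?lee_fin ?prodr_ge0.
- apply: emeasurable_funM; apply/measurable_EFinP.
    exact: measurableT_comp.
  exact: (measurableT_comp (@measurable_prod_tnth n _ mphi)  measurable_snd).
transitivity (\int[lebesgue_measure]_x ((phi x)%:E * (z ^+ n)%:E)).
  apply: eq_integral => x _ /=; rewrite /fubini_F/=.
  rewrite ge0_integralZl ?lee_fin ?ih//.
    by apply/measurable_EFinP; exact: measurable_prod_tnth.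
  by move=> y _; rewrite lee_fin prodr_ge0.
have z0 : (0 <= z)%R.
  by rewrite -lee_fin -phiz; apply: integral_ge0 => x _; rewrite lee_fin.
rewrite ge0_integralZr ?phiz ?exprS ?EFinM//.
- exact/measurable_EFinP.
- by move=> x _; rewrite lee_fin.
- by rewrite lee_fin exprn_ge0.
Qed.

End lebesgue_n_integral.

Section exponential_bounds.
Context (R : realType).
Implicit Types (w : R -> R) (n : nat).

Lemma measurable_expR_comp w : measurable_fun setT w ->
  measurable_fun setT (fun x => expR (w x)).
Proof. by move=> mw; exact: measurableT_comp. Qed.

Lemma integral_lebesgue_n_expR n w (z : R) : measurable_fun setT w ->
  \int[lebesgue_measure]_x (expR (w x))%:E = z%:E ->
  \int[lebesgue_n R n]_x (expR (\sum_(i < n) w (tnth x i)))%:E = (z ^+ n)%:E.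
Proof.
move=> mw wz; under eq_integral do rewrite expR_sum.
exact: (integral_lebesgue_n_prod _ (measurable_expR_comp mw)).
Qed.

(** Exponential Chebyshev inequality: the indicator of [A] is dominated by the exponential of the
    sum of [w] minus [c]. *)
Lemma lebesgue_n_exp_le n w (z c : R) (A : set (Rn R n)) :
  measurable A -> measurable_fun setT w ->
  \int[lebesgue_measure]_x (expR (w x))%:E = z%:E ->
  (forall x, A x -> c <= \sum_(i < n) w (tnth x i))%R ->
  lebesgue_n R n A <= (expR (- c) * z ^+ n)%:E.
Proof.
move=> mA mw wz Ac; rewrite EFinM -(integral_lebesgue_n_expR n mw wz).
have mS := @measurable_sum_tnth R n _ mw.
have mE : measurable_fun setT
    (fun x : Rn R n => (expR (\sum_(i < n) w (tnth x i)))%:E).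
  by apply/measurable_EFinP; exact: (measurableT_comp _ mS).
rewrite -ge0_integralZl ?lee_fin ?expR_ge0//.
have := integral_indic (lebesgue_n R n) measurableT mA; rewrite setIT => <-.
apply: ge0_le_integral => //.
- by apply/measurable_EFinP; exact: measurable_indic.
- exact: measurable_funeM.
- move=> x _; rewrite -EFinM lee_fin indicE; case: (boolP (x \in A)) => [|_].
    rewrite inE => Ax; rewrite -expRD -[leLHS]expR0 ler_expR.
    by have := Ac _ Ax; lra.
  by rewrite mulr_ge0 ?expR_ge0.
Qed.

(* Exponential tilting without normalisation: off [A] the density [e^w] is
   dominated by one of finitely many densities [e^(w_k - b_k)]. *)
Lemma lebesgue_n_exp_ge n w (z c : R) (A : set (Rn R n))
    m (wk : 'I_m -> R -> R) (zk bk : 'I_m -> R) :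
  measurable A -> measurable_fun setT w ->
  (forall k, measurable_fun setT (wk k)) ->
  \int[lebesgue_measure]_x (expR (w x))%:E = z%:E ->
  (forall k, \int[lebesgue_measure]_x (expR (wk k x))%:E = (zk k)%:E) ->
  (forall x, A x -> \sum_(i < n) w (tnth x i) <= c)%R ->
  (forall x, ~ A x -> exists k,
    bk k + \sum_(i < n) w (tnth x i) <= \sum_(i < n) wk k (tnth x i))%R ->
  (z ^+ n)%:E <= (expR c)%:E * lebesgue_n R n A +
    (\sum_(k < m) expR (- bk k) * zk k ^+ n)%:E.
Proof.
move=> mA mw mwk wz wkz Ac nA.
have mE (v : R -> R) : measurable_fun setT v -> measurable_fun setT
    (fun x : Rn R n => (expR (\sum_(i < n) v (tnth x i)))%:E).
  move=> mv; apply/measurable_EFinP.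
  exact: (measurableT_comp _ (@measurable_sum_tnth R n _ mv)).
rewrite -(integral_lebesgue_n_expR n mw wz) -sumEFin.
under [in leRHS]eq_bigr => k _.
  rewrite EFinM -(integral_lebesgue_n_expR n (mwk k) (wkz k)).
  rewrite -ge0_integralZl ?lee_fin ?expR_ge0//; last exact: mE.
  over.
have mIA : measurable_fun setT (EFin \o (\1_A : Rn R n -> R)).
  by apply/measurable_EFinP; exact: measurable_indic.
rewrite -ge0_integral_sum//; last first.
  by move=> k; apply: measurable_funeM; exact: mE.
have := integral_indic (lebesgue_n R n) measurableT mA; rewrite setIT => <-.
rewrite -ge0_integralZl//.
rewrite -ge0_integralD//; last 3 first.
- exact: measurable_funeM.
- move=> x _; apply: sume_ge0 => k _.
  by rewrite mule_ge0// lee_fin expR_ge0.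
- by apply: emeasurable_sum => k; apply: measurable_funeM; exact: mE.
apply: ge0_le_integral => //.
- exact: mE.
- apply: emeasurable_funD; first exact: measurable_funeM.
  by apply: emeasurable_sum => k; apply: measurable_funeM; exact: mE.
move=> x _; rewrite [X in _ + X](_ : _ = (\sum_(k < m)
  expR (- bk k) * expR (\sum_(i < n) wk k (tnth x i)))%:E); last first.
  by rewrite -sumEFin; apply: eq_bigr.
rewrite -EFinM -EFinD lee_fin indicE; case: (boolP (x \in A)) => Ax.
  move: Ax; rewrite inE => Ax.
  by rewrite mulr1 ler_wpDr ?ler_expR ?Ac// sumr_ge0//.
move: Ax; rewrite notin_setE => /nA[k bw].
rewrite mulr0 add0r (bigD1 k)//= -expRD ler_wpDr//.
  by rewrite sumr_ge0// => j _; rewrite mulr_ge0 ?expR_ge0.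
by rewrite ler_expR; lra.
Qed.

End exponential_bounds.

(** * Second differences of the Laplace transform and approximate minimisers *)

Section laplace_transform.
Context (R : realType) (f g : R -> R).
Hypotheses (mf : measurable_fun setT f) (mg : measurable_fun setT g).
Hypotheses (f0 : forall x, (0 <= f x)%R) (g0 : forall x, (0 <= g x)%R).
Hypothesis Zoo : forall s t : R, (s < 0)%R ->
  \int[lebesgue_measure]_x (expR (s * f x + t * g x))%:E < +oo.

Definition laplace (s t : R) : R :=
  fine (\int[lebesgue_measure]_x (expR (s * f x + t * g x))%:E).

Local Notation Z := laplace.

Lemma measurable_exponent s t : measurable_fun setT (fun x => s * f x + t * g x)%R.
Proof.
by apply: measurable_funD; apply: measurable_funM => //; exact: measurable_cst.
Qed.

Lemma measurable_tilt s t :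
  measurable_fun setT (fun x => (expR (s * f x + t * g x))%:E).
Proof.
by apply/measurable_EFinP; apply: measurableT_comp => //; exact: measurable_exponent.
Qed.

Lemma laplaceE s t : (s < 0)%R ->
  \int[lebesgue_measure]_x (expR (s * f x + t * g x))%:E = (Z s t)%:E.
Proof.
move=> s0; rewrite /laplace fineK// ge0_fin_numE ?Zoo//.
by apply: integral_ge0 => x _; rewrite lee_fin expR_ge0.
Qed.

Lemma laplace_gt0 s t : (s < 0)%R -> (0 < Z s t)%R.
Proof.
move=> s0; rewrite lt0r.
have -> : (0 <= Z s t)%R.
  rewrite -lee_fin -laplaceE//; apply: integral_ge0 => x _.
  by rewrite lee_fin expR_ge0.
rewrite andbT; apply/negP => /eqP Z0.
have : \int[lebesgue_measure]_x `|(expR (s * f x + t * g x))%:E| = 0 :> \bar R.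
  transitivity (Z s t)%:E; last by rewrite Z0.
  rewrite -laplaceE//; apply: eq_integral => x _.
  by rewrite gee0_abs// lee_fin expR_ge0.
(* A zero integral would make a positive integrand vanish almost everywhere, so the null set [A]
   would contain [0, 1]. *)
move=> /ae_eq_integral_abs => /(_ measurableT (measurable_tilt _ _)).
move=> [A [mA A0 sA]].
have : lebesgue_measure (`[0%R, 1%R]%classic : set R) <= lebesgue_measure A.
  apply: le_measure; rewrite ?inE// => x _; apply: sA => /= /(_ Logic.I)[] /eqP.
  by rewrite gt_eqF// expR_gt0.
by rewrite A0 lebesgue_measure_itv/= lte01 oppr0 adde0 lee_fin ler10.
Qed.

Lemma laplace_le s t s' t' :
  (s <= s' < 0)%R -> (t <= t')%R -> (Z s t <= Z s' t')%R.
Proof.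
move=> /andP[ss' s'0] tt'; have s0 := le_lt_trans ss' s'0.
rewrite -lee_fin -!laplaceE//.
apply: ge0_le_integral => //=; try exact: measurable_tilt.
by move=> x _; rewrite lee_fin ler_expR lerD// ler_wpM2r.
Qed.

(** For x >= 0 put a = e^x and b = e^(-x). The left side is b (a - 1)^2, the right side is b (x
    a)^2, and a - 1 <= x a is 1 - x <= e^(-x) multiplied by a. *)
Lemma expR_second_difference (x : R) :
  (expR x + expR (- x) - 2 <= x ^+ 2 * expR `|x|)%R.
Proof.
wlog x0 : x / (0 <= x)%R.
  move=> H; have [|/ltW x0] := lerP 0 x; first exact: H.
  have := H (- x)%R; rewrite oppr_ge0 => /(_ x0).
  by rewrite opprK normrN sqrrN (addrC (expR x)).
rewrite ger0_norm//.
have e1 : (1 - x <= expR (- x))%R by rewrite expR_ge1Dx.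
have := expRxMexpNx_1 x; have := expR_gt0 x; have := expR_gt0 (- x).
set a := expR x; set b := expR (- x) => b0 a0 ab.
have aab : (a ^+ 2 * b = a)%R by rewrite expr2 -mulrA ab mulr1.
have -> : (a + b - 2 = b * (a - 1) ^+ 2)%R.
  rewrite (_ : b * (a - 1) ^+ 2 = a ^+ 2 * b - 2 * (a * b) + b)%R; last by ring.
  by rewrite aab ab; ring.
have -> : (x ^+ 2 * a = b * (x * a) ^+ 2)%R by rewrite -[in LHS]aab; ring.
have a1 : (1 <= a)%R by have := expR_ge1Dx x; rewrite -/a; lra.
apply: ler_wpM2l; first exact: ltW.
have := ler_wpM2l (ltW a0) e1; rewrite -/b ab => e2.
by rewrite ler_sqr ?nnegrE ?subr_ge0 ?mulr_ge0 ?(ltW a0)//; lra.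
Qed.

(** The scalar bound is applied under the integral to h (a f + b g), whose absolute value is at most
    h W with W = M (f + g). The factor W^2 e^(k W) is absorbed into e^(2 k W), that is, into a shift
    of both parameters by 2 k M; the condition on s + 2 k M keeps the shifted integral finite. *)
Lemma laplace_second_difference (s t a b M k h : R) :
  (0 < k)%R -> (0 <= h <= k)%R -> (0 <= M)%R -> (`|a| <= M)%R -> (`|b| <= M)%R -> (s + 2 * k * M < 0)%R ->
  (Z (s + h * a) (t + h * b) + Z (s - h * a) (t - h * b) <=
   2 * Z s t + 4 / k ^+ 2 * h ^+ 2 * Z (s + 2 * k * M) (t + 2 * k * M))%R.
Proof.
move=> k0 /andP[h0 hk] M0 aM bM sM.
have s0 : (s < 0)%R by apply: le_lt_trans sM; rewrite lerDl !mulr_ge0// ltW.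
have haM : (`|h * a| <= k * M)%R by rewrite normrM ger0_norm// ler_pM.
have [hal har] : (- (k * M) <= h * a)%R /\ (h * a <= k * M)%R.
  by move: haM; rewrite ler_norml => /andP.
have kM0 : (0 <= k * M)%R by rewrite mulr_ge0// ltW.
have sp : (s + h * a < 0)%R by lra.
have sn : (s - h * a < 0)%R by lra.
have c0 : (0 <= 4 / k ^+ 2 * h ^+ 2)%R.
  by rewrite !mulr_ge0// ?sqr_ge0// invr_ge0 sqr_ge0.
rewrite -lee_fin !EFinD !(EFinM 2) (EFinM (4 / k ^+ 2 * h ^+ 2)) -!laplaceE//.
rewrite -!ge0_integralZl ?lee_fin//; try exact: measurable_tilt.
have mcE c s' t' : measurable_fun setT
    (fun x => c%:E * (expR (s' * f x + t' * g x))%:E).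
  by apply: measurable_funeM; exact: measurable_tilt.
rewrite -!ge0_integralD//; try exact: measurable_tilt; try exact: mcE; last first.
  by move=> x _; rewrite mule_ge0 ?lee_fin.
apply: ge0_le_integral => //.
- by move=> x _; rewrite adde_ge0 ?lee_fin.
- by apply: emeasurable_funD; exact: measurable_tilt.
- by apply: emeasurable_funD; exact: mcE.
move=> x _; rewrite -!EFinM -!EFinD lee_fin.
set w := (s * f x + t * g x)%R.
set y := (a * f x + b * g x)%R.
set W := (M * (f x + g x))%R.
have -> : ((s + h * a) * f x + (t + h * b) * g x = w + h * y)%R.
  by rewrite /w /y; ring.
have -> : ((s - h * a) * f x + (t - h * b) * g x = w + - (h * y))%R.
  by rewrite /w /y; ring.
have -> : ((s + 2 * k * M) * f x + (t + 2 * k * M) * g x = w + 2 * (k * W))%R.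
  by rewrite /w /W; ring.
rewrite !(expRD w).
have yW : (`|y| <= W)%R.
  rewrite /y /W mulrDr (le_trans (ler_normD _ _))// lerD// normrM.
    by rewrite (ger0_norm (f0 x)) ler_wpM2r.
  by rewrite (ger0_norm (g0 x)) ler_wpM2r.
have W0 : (0 <= W)%R by rewrite mulr_ge0// addr_ge0.
have hyW : (`|h * y| <= k * W)%R by rewrite normrM ger0_norm// ler_pM.
have h2 : ((h * y) ^+ 2 <= h ^+ 2 * W ^+ 2)%R.
  rewrite exprMn ler_wpM2l ?sqr_ge0//.
  by rewrite -(real_normK (num_real y)) ler_sqr ?nnegrE.
(* With z = k W / 2 this is (2 z)^2 <= (2 e^z)^2; it is the source of the constant 4 / k^2. *)
have kW : ((k * W) ^+ 2 <= 4 * expR (k * W))%R.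
  have -> : (k * W = k * W / 2 + k * W / 2)%R by lra.
  rewrite expRD; have := expR_ge1Dx (k * W / 2).
  have : (0 <= k * W / 2)%R by rewrite divr_ge0// mulr_ge0// ltW.
  set z := (k * W / 2)%R => z0 ez.
  rewrite (_ : 4 * _ = (2 * expR z) ^+ 2)%R; last by ring.
  by rewrite ler_sqr ?nnegrE; lra.
have W2 : (W ^+ 2 <= 4 / k ^+ 2 * expR (k * W))%R.
  rewrite mulrAC ler_pdivlMr ?exprn_gt0// mulrC -exprMn//.
have main : (expR (h * y) + expR (- (h * y)) - 2 <=
    4 / k ^+ 2 * h ^+ 2 * expR (2 * (k * W)))%R.
  apply: (le_trans (expR_second_difference _)).
  apply: (@le_trans _ _ (h ^+ 2 * W ^+ 2 * expR (k * W)))%R.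
    by rewrite ler_pM ?sqr_ge0 ?expR_ge0 ?ler_expR.
  rewrite (_ : 2 * (k * W) = k * W + k * W)%R; last by ring.
  rewrite expRD.
  rewrite [leRHS](_ : _ = h ^+ 2 * (4 / k ^+ 2 * expR (k * W)) * expR (k * W))%R.
    by rewrite ler_wpM2r ?expR_ge0// ler_wpM2l ?sqr_ge0.
  by ring.
have := ler_wpM2l (expR_ge0 w) main; lra.
Qed.

End laplace_transform.

(** * Almost minimisers of the penalised log-Laplace transform *)

Section near_critical_point.
Context (R : realType) (Z : R -> R -> R).
Local Open Scope ring_scope.
Hypothesis Z_gt0 : forall s t : R, s < 0 -> 0 < Z s t.
Hypothesis Z_le : forall s t s' t' : R, s <= s' < 0 -> t <= t' -> Z s t <= Z s' t'.
Hypothesis Z_second_difference : forall s t a b M k h : R, 0 < k -> 0 <= h <= k ->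
  0 <= M -> `|a| <= M -> `|b| <= M -> s + 2 * k * M < 0 ->
  Z (s + h * a) (t + h * b) + Z (s - h * a) (t - h * b) <=
  2 * Z s t + 4 / k ^+ 2 * h ^+ 2 * Z (s + 2 * k * M) (t + 2 * k * M).

(* The logarithm keeps minimising points away from [s = 0], the quadratic part
   keeps them bounded; along the four directions below the penalty still
   increases at most linearly with a small slope. *)
Let pen (e s t : R) : R := e * (- ln (- s) + (s ^+ 2 + t ^+ 2) / 2).

(** By ln y <= y - 1 the barrier is at least s + 1, and s^2 / 2 + s + 1 = s^2 / 4 + (s / 2 +
    1)^2. *)
Let pen_ge (e s t : R) : 0 <= e -> s < 0 ->
  e * (s ^+ 2 / 4 + t ^+ 2 / 2) <= pen e s t.
Proof.
move=> e0 s0; rewrite /pen ler_wpM2l//.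
have Ns : 0 < - s by lra.
have l1 : ln (- s) <= - s - 1.
  by rewrite (le_trans _ (@le_ln1Dx R (- s - 1) _)) ?subrKC//; lra.
by have := sqr_ge0 (s / 2 + 1); rewrite sqrrD1; lra.
Qed.

(** Moving away from s = 0 lowers the barrier, so only the quadratic part contributes. *)
Let pen_shift_l (e s t h : R) : 0 <= e -> s < 0 -> 0 < h ->
  pen e (s - h) t - pen e s t <= e * (h * - s + h ^+ 2 / 2).
Proof.
move=> e0 s0 h0; rewrite /pen -mulrBr ler_wpM2l//.
have l1 : ln (- s) <= ln (- (s - h)) by rewrite ler_ln ?posrE; lra.
by move: l1; set l := ln _; set l' := ln _; lra.
Qed.

Let pen_shift_r (e s t h : R) : 0 <= e ->
  pen e s (t + h) - pen e s t <= e * (`|h| * `|t| + h ^+ 2 / 2).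
Proof.
move=> e0; rewrite /pen -mulrBr ler_wpM2l//.
by have := ler_norm (h * t); rewrite normrM; set l := ln _; lra.
Qed.

(** Contracting towards the origin lowers the quadratic part, and the barrier grows by -ln (1 - h)
    <= h / (1 - h) <= 2 h. *)
Let pen_scale (e s t h : R) : 0 <= e -> s < 0 -> 0 < h <= 1 / 2 ->
  pen e (s - h * s) (t - h * t) - pen e s t <= e * (2 * h).
Proof.
move=> e0 s0 /andP[h0 h12]; have h1 : 0 < 1 - h by lra.
rewrite /pen -mulrBr ler_wpM2l//.
rewrite (_ : - (s - h * s) = - s * (1 - h)); last by ring.
rewrite lnM ?posrE ?oppr_gt0//.
have lnh : - ln (1 - h) <= 2 * h.
  rewrite -lnV ?posrE//.
  have i0 : 0 < (1 - h)^-1 by rewrite invr_gt0.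
  have ih : (1 - h)^-1 - 1 <= 2 * h.
    by rewrite lerBlDr -[leLHS]mul1r ler_pdivrMr//; nra.
  apply: le_trans ih; rewrite -[leLHS](congr1 (@ln R) (subrKC 1 _)).
  by apply: le_ln1Dx; lra.
rewrite (_ : s - h * s = s * (1 - h)); last by ring.
rewrite (_ : t - h * t = t * (1 - h)); last by ring.
rewrite !exprMn -mulrDl.
have h2 : (1 - h) ^+ 2 <= 1 by nra.
have := ler_wpM2l (addr_ge0 (sqr_ge0 s) (sqr_ge0 t)) h2.
by move: lnh; set l := ln (1 - h); set l' := ln _; lra.
Qed.

(* [z], [zp], [zm] are the values of the Laplace transform at a point and at
   its two neighbours in opposite directions. *)
Let opposite_neighbour (z zp zm c d : R) : 0 < z -> 0 < zm ->
  zp + zm <= (2 + d / 2) * z -> - c - d / 2 <= ln zm - ln z ->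
  zp <= z * expR (c + d).
Proof.
move=> z0 zm0 sd lnz; rewrite mulrC -ler_pdivrMr//.
apply: le_trans (expR_ge1Dx _).
(* Since zm / z >= 1 + ln (zm / z) >= 1 - c - d / 2, the other ratio is at most 1 + c + d. *)
have : zp / z + zm / z <= 2 + d / 2 by rewrite -mulrDl ler_pdivrMr.
have : 1 - c - d / 2 <= zm / z.
  have q0 : 0 < zm / z by rewrite divr_gt0.
  have := @le_ln1Dx R (zm / z - 1) ltac:(lra).
  by rewrite subrKC ln_div ?posrE//; lra.
by lra.
Qed.

(** Replaces the equation grad ln Z = (u, v) by one-sided bounds at a single step [h]. From an
    almost minimiser of the penalised function, a step -h (a, b) can lower it only slightly; by
    [opposite_neighbour] this bounds Z after the step +h (a, b). *)
Lemma near_critical_point (u v j d : R) : 0 < d ->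
  (forall s t : R, s < 0 -> s * u + t * v - ln (Z s t) <= j) ->
  exists s t h : R, [/\ s < 0, 0 < h &
    forall a b : R, (a, b) \in [:: (1, 0); (0, 1); (0, -1); (s, t)] ->
      s + h * a < 0 /\
      Z (s + h * a) (t + h * b) <= Z s t * expR (h * (a * u + b * v + d))].
Proof.
move=> d0 Fj.
pose F s t := ln (Z s t) - s * u - t * v.
have F_ge s t : s < 0 -> - j <= F s t.
  by move=> s0; rewrite /F; have := Fj s t s0; lra.
(* [A] bounds the penalty on the sublevel set {G <= inf G + 1}, which
   therefore lies in a box determined by [m] and [M]; all later constants only
   depend on this box, so the point can be chosen last. *)
pose A := F (-1) 0 + 1 / 2 + j + 1.
have A1 : 1 <= A by rewrite /A; have := F_ge (-1) 0 (ltrN10 R); lra.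
(* The bound 1 makes the penalty at (-1, 0) at most 1/2, and d / 8 serves the scaling direction. The
   last term turns e x^2 <= 4 A into (e |x|)^2 <= (d / 8)^2, so the slopes e |s| and e |t| are
   small. *)
pose e := Num.min 1 (Num.min (d / 8) ((d / 8) ^+ 2 / (4 * A))).
have e0 : 0 < e.
  by rewrite /e !lt_min ltr01 divr_gt0 ?divr_gt0 ?exprn_gt0 ?mulr_gt0//; lra.
have e1 : e <= 1 by rewrite /e ge_min lexx.
have ed : e <= d / 8 by rewrite /e !ge_min lexx orbT.
have eA : 4 * A * e <= (d / 8) ^+ 2.
  rewrite mulrC -ler_pdivlMr; last by lra.
  by rewrite /e !ge_min lexx !orbT.
pose G s t := F s t + pen e s t.
have G_ge s t : s < 0 -> - j <= G s t.
  move=> s0; rewrite /G; have := pen_ge t (ltW e0) s0; have := F_ge s t s0.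
  have : 0 <= e * (s ^+ 2 / 4 + t ^+ 2 / 2).
    by rewrite mulr_ge0 ?addr_ge0 ?divr_ge0 ?sqr_ge0// ltW.
  by lra.
pose S := [set G p.1 p.2 | p in [set p : R * R | p.1 < 0]]%classic.
have S0 : S (G (-1) 0) by exists (-1, 0) => //=; exact: ltrN10.
have Slb : lbound S (- j) by move=> _ [p /= p0 <-]; exact: G_ge.
have infS : has_inf S by split; [exists (G (-1) 0)|exists (- j)].
have infSG : inf S <= F (-1) 0 + 1 / 2.
  apply: (@le_trans _ _ (G (-1) 0)); first by apply: ge_inf => //; exists (- j).
  by rewrite /G /pen opprK ln1; nra.
(* The barrier gives -ln (-s) <= A / e, hence m <= -s; the quadratic part gives squares at most 4 A
   / e, hence below M^2. *)
pose m := expR (- (A / e)).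
have m0 : 0 < m by exact: expR_gt0.
pose M := 1 + 4 * A / e.
have Ae0 : 0 <= A / e by rewrite divr_ge0//; lra.
have M1 : 1 <= M by rewrite /M -mulrA; lra.
have M0 : 0 < M by lra.
(* A shift by 2 k M <= m / 2 keeps every point of the box in s < 0; the bound 1/2 is needed for
   [pen_scale]. *)
pose k := Num.min (1 / 2) (m / (4 * M)).
have k0 : 0 < k by rewrite /k lt_min !divr_gt0 ?mulr_gt0.
have k2 : k <= 1 / 2 by rewrite /k ge_min lexx.
have kM : 2 * k * M <= m / 2.
  have : k <= m / (4 * M) by rewrite /k ge_min lexx orbT.
  by rewrite ler_pdivlMr ?mulr_gt0//; lra.
have box s t : s < 0 -> G s t <= inf S + 1 ->
  [/\ m <= - s, - s <= M, `|t| <= M, e * - s <= d / 8 & e * `|t| <= d / 8].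
  move=> s0 Gst.
  have penA : pen e s t <= A.
    by move: Gst; rewrite /G /A; have := F_ge s t s0; lra.
  have pen2 := le_trans (pen_ge t (ltW e0) s0) penA.
  have s2 : e * s ^+ 2 <= 4 * A.
    by have := sqr_ge0 t; have := mulr_ge0 (ltW e0) (sqr_ge0 t); lra.
  have t2 : e * t ^+ 2 <= 4 * A.
    by have := mulr_ge0 (ltW e0) (sqr_ge0 s); lra.
  have abs_le x : e * x ^+ 2 <= 4 * A -> `|x| <= M /\ e * `|x| <= d / 8.
    move=> x2; split.
      rewrite -(@ler_pXn2r _ 2%N) ?nnegrE// ?(ltW M0)// real_normK ?num_real//.
      have : x ^+ 2 <= 4 * A / e by rewrite ler_pdivlMr// mulrC.
      have y0 : 0 <= 4 * A / e by rewrite -mulrA; lra.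
      rewrite /M; move: y0; set y := 4 * A / e => y0 xy.
      by rewrite (_ : (1 + y) ^+ 2 = 1 + 2 * y + y ^+ 2); [nra|ring].
    rewrite -(@ler_pXn2r _ 2%N) ?nnegrE ?mulr_ge0 ?(ltW e0)//; last by lra.
    rewrite exprMn real_normK ?num_real// expr2 -mulrA.
    apply: le_trans eA; rewrite mulrC ler_wpM2r//; exact: ltW.
  have [sM es] := abs_le _ s2; have [tM et] := abs_le _ t2.
  rewrite ltr0_norm// in sM es; split => //.
  have : - ln (- s) <= A / e.
    rewrite ler_pdivlMr// mulrC; apply: le_trans penA.
    rewrite /pen ler_wpM2l ?(ltW e0)// lerDl divr_ge0// addr_ge0// sqr_ge0//.
  rewrite lerNl /m => lns.
  by rewrite -[leRHS]lnK ?posrE ?oppr_gt0// ler_expR.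
(* By monotonicity of Z, the values at two corners bound the relative error constant of the second
   difference uniformly on the box. *)
pose C := 4 / k ^+ 2 * (Z (- (m / 2)) (M + m / 2) / Z (- M) (- M)).
have C0 : 0 <= C.
  by rewrite mulr_ge0 ?divr_ge0 ?sqr_ge0// ltW// Z_gt0; move: m0 M0; clear; lra.
pose h := Num.min k (Num.min (d / 4) (d / (2 * (C + 1)))).
have h0 : 0 < h by rewrite /h lt_min k0 lt_min !divr_gt0// mulr_gt0//; lra.
have hk : h <= k by rewrite /h ge_min lexx.
have hd : h <= d / 4 by rewrite /h !ge_min lexx orbT.
have Ch : C * h <= d / 2.
  have : h <= d / (2 * (C + 1)) by rewrite /h !ge_min lexx !orbT.
  by rewrite ler_pdivlMr; [nra|lra].
(* The bound 1 puts the point in the box. The other half of the slack h d / 2 allowed by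
   [opposite_neighbour] is spent on the change of the penalty. *)
pose eta := Num.min 1 (h * d / 4).
have eta0 : 0 < eta by rewrite /eta lt_min ltr01 divr_gt0// mulr_gt0.
have [_ [[s t] /= s0 <-] Gst] := inf_adherent eta0 infS.
have [|ms sM tM es et] := box s t s0.
  by rewrite (le_trans (ltW Gst))// lerD2l /eta ge_min lexx.
have step a b : `|a| <= M -> `|b| <= M -> s - h * a < 0 ->
    pen e (s - h * a) (t - h * b) - pen e s t <= h * d / 4 ->
  s + h * a < 0 /\
  Z (s + h * a) (t + h * b) <= Z s t * expR (h * (a * u + b * v + d)).
  move=> aM bM sa pend.
  have haM : `|h * a| <= k * M.
    by rewrite normrM (gtr0_norm h0) ler_pM// ltW.
  have [hal har] : - (k * M) <= h * a /\ h * a <= k * M.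
    by move: haM; rewrite ler_norml => /andP.
  have sp : s + h * a < 0 by move: har kM ms m0; clear; lra.
  split => //.
  have Gq : inf S <= G (s - h * a) (t - h * b).
    by apply: ge_inf; [exists (- j)|exists (s - h * a, t - h * b)].
  have etah : eta <= h * d / 4 by rewrite /eta ge_min lexx orbT.
  have Zst := Z_gt0 t s0.
  have bnd : Z (s + 2 * k * M) (t + 2 * k * M) / Z s t <=
      Z (- (m / 2)) (M + m / 2) / Z (- M) (- M).
    have [Mt tM'] : - M <= t /\ t <= M by move: tM; rewrite ler_norml => /andP.
    have mM : m <= M by exact: le_trans sM.
    rewrite ler_pM ?invr_ge0 ?(ltW Zst)//.
    - by rewrite ltW// Z_gt0//; move: s0 ms kM m0; clear; lra.
    - by apply: Z_le; move: s0 ms kM m0 tM'; clear; lra.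
    - rewrite lef_pV2 ?posrE ?Z_gt0//; last by move: M0; clear; lra.
      by apply: Z_le => //; rewrite s0 andbT; move: sM; clear; lra.
  have hk' : 0 <= h <= k by rewrite (ltW h0).
  have sk : s + 2 * k * M < 0 by move: s0 ms kM m0; clear; lra.
  have sd := Z_second_difference t k0 hk' (ltW M0) aM bM sk.
  have Ch2 : 4 / k ^+ 2 * h ^+ 2 * Z (s + 2 * k * M) (t + 2 * k * M) <=
      h * d / 2 * Z s t.
    apply: (@le_trans _ _ (h * (C * h) * Z s t)); last first.
      by rewrite -[h * d / 2]mulrA ler_wpM2r ?(ltW Zst)// ler_wpM2l// ltW.
    rewrite (_ : h * (C * h) * Z s t = 4 / k ^+ 2 * h ^+ 2 *
      (Z (- (m / 2)) (M + m / 2) / Z (- M) (- M) * Z s t)); last first.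
      by rewrite /C; ring.
    apply: ler_wpM2l; last by rewrite -ler_pdivrMr.
    by rewrite mulr_ge0 ?divr_ge0 ?sqr_ge0.
  rewrite mulrDr; apply: opposite_neighbour Zst (Z_gt0 _ sa) _ _.
    by apply: (le_trans sd); rewrite [leRHS]mulrDl lerD2l.
  by move: pend etah Gq (ltW Gst); rewrite /G /F; clear; lra.
have eh2 : e * (h ^+ 2 / 2) <= h * (d / 8).
  have h2 : h ^+ 2 / 2 <= h * (d / 8).
    by rewrite expr2 -mulrA ler_wpM2l ?(ltW h0)//; move: hd; clear; lra.
  by apply: le_trans h2; rewrite ler_piMl// divr_ge0 ?sqr_ge0.
have es2 : e * (h * - s + h ^+ 2 / 2) <= h * d / 4.
  have := ler_wpM2l (ltW h0) es; move: eh2; clear; lra.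
have et2 : e * (h * `|t| + h ^+ 2 / 2) <= h * d / 4.
  have := ler_wpM2l (ltW h0) et; move: eh2; clear; lra.
exists s, t, h; split => // a b; rewrite !inE => /or4P[] /eqP[-> ->].
- apply: step; rewrite ?normr1 ?normr0 ?(ltW M0)//.
    by rewrite mulr1; move: s0 h0; clear; lra.
  by rewrite mulr0 subr0 mulr1 (le_trans (pen_shift_l _ (ltW e0) _ _)).
- apply: step; rewrite ?normr1 ?normr0 ?(ltW M0) ?mulr0 ?subr0//.
  rewrite mulr1 (le_trans (pen_shift_r _ _ _ (ltW e0)))// normrN sqrrN.
  by rewrite gtr0_norm.
- apply: step; rewrite ?normrN1 ?normr0 ?(ltW M0) ?mulr0 ?subr0//.
  by rewrite mulrN1 opprK (le_trans (pen_shift_r _ _ _ (ltW e0)))// gtr0_norm.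
- have h12 : h <= 1 / 2 by exact: le_trans k2.
  apply: step => //; first by rewrite ltr0_norm.
    by rewrite -[X in X - _]mul1r -mulrBl pmulr_rlt0//; move: h12; clear; lra.
  apply: (le_trans (pen_scale t (ltW e0) s0 _)); first by rewrite h0.
  by have := ler_wpM2l (ltW h0) ed; clear; lra.
Qed.

End near_critical_point.

(** * Lower bound by tilting *)

Lemma near_expRN_le (R : realType) (c e : R) : (0 < c)%R -> (0 < e)%R ->
  \forall n \near \oo, (expR (- (n%:R * c)) <= e)%R.
Proof.
move=> c0 e0; near=> n.
rewrite -[leRHS]lnK ?posrE// ler_expR lerNl -ler_pdivrMr//.
by near: n; exact: nbhs_infty_ger.
Unshelve. all: by end_near. Qed.

Section tilted_lower_bound.
Context (R : realType) (f g : R -> R).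
Hypotheses (mf : measurable_fun setT f) (mg : measurable_fun setT g).
Hypotheses (f0 : forall x, (0 <= f x)%R) (g0 : forall x, (0 <= g x)%R).
Hypothesis Zoo : forall s t : R, (s < 0)%R ->
  \int[lebesgue_measure]_x (expR (s * f x + t * g x))%:E < +oo.
Local Notation Z := (laplace f g).

Definition level_set (n : nat) (u v d : R) : set (Rn R n) :=
  [set x | (\sum_(i < n) f (tnth x i) <= n%:R * u)%R /\
           (`|\sum_(i < n) g (tnth x i) - n%:R * v| <= n%:R * d)%R].
Arguments level_set : clear implicits.

Lemma measurable_le_fun d (T : measurableType d) (h1 h2 : T -> R) :
  measurable_fun setT h1 -> measurable_fun setT h2 ->
  measurable [set x | (h1 x <= h2 x)%R].
Proof.
move=> m1 m2; have := measurable_fun_ler m1 m2 => /(_ measurableT [set true]).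
by rewrite setTI; apply.
Qed.

Lemma measurable_level_set n u v d : measurable (level_set n u v d).
Proof.
apply: measurableI; apply: measurable_le_fun; try exact: measurable_cst.
  exact: measurable_sum_tnth.
apply: measurableT_comp => //; apply: measurable_funB; last exact: measurable_cst.
exact: measurable_sum_tnth.
Qed.

(** Under the tilt at the point given by [near_critical_point], a vector outside [A] violates one of
    four linear constraints, each of exponentially small tilted mass. So [A] carries at least half
    of the total mass Z^n, and an upper bound on the tilting density over [A] converts this mass
    into volume. *)
Lemma level_set_ge (u v j d : R) : (0 < d)%R ->
  (forall s t : R, s < 0 -> s * u + t * v - ln (Z s t) <= j)%R ->
  \forall n \near \oo,
    (expR (- (n%:R * (j + d))))%:E <= lebesgue_n R n (level_set n (u + d) v d).
Proof.
move=> d0 Fj; have d20 : (0 < d / 2)%R by lra.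
have d40 : (0 < d / 4)%R by lra.
have Zgt0 := laplace_gt0 mf mg Zoo.
have [s [t [h [s0 h0 crit]]]] := near_critical_point Zgt0
  (laplace_le mf mg f0 g0 Zoo) (laplace_second_difference mf mg f0 g0 Zoo) d40 Fj.
pose q := [:: (1, 0); (0, 1); (0, -1); (s, t)]%R : seq (R * R).
pose qa (k : 'I_4) := (nth (0, 0)%R q k).1.
pose qb (k : 'I_4) := (nth (0, 0)%R q k).2.
have qk k : (qa k, qb k) \in q by rewrite -surjective_pairing mem_nth.
have Zst := Zgt0 s t s0.
near=> n.
(* The added constraint corresponds to the direction (s, t); it bounds the tilting density on
   [A]. *)
pose A := [set x : Rn R n | level_set n (u + d) v d x /\
  (\sum_(i < n) (s * f (tnth x i) + t * g (tnth x i)) <=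
    n%:R * (s * u + t * v + d / 2))%R].
have mA : measurable A.
  apply: measurableI; first exact: measurable_level_set.
  apply: measurable_le_fun; last exact: measurable_cst.
  exact: (@measurable_sum_tnth R n _ (measurable_exponent mf mg s t)).
apply: (@le_trans _ _ (lebesgue_n R n A)); last first.
  by apply: le_measure; rewrite ?inE//; [exact: measurable_level_set|by move=> x []].
pose b k := (h * (n%:R * (qa k * u + qb k * v + d / 2)))%R.
have := @lebesgue_n_exp_ge R n (fun x => s * f x + t * g x)%R (Z s t)
  (n%:R * (s * u + t * v + d / 2)) A 4
  (fun k x => (s + h * qa k) * f x + (t + h * qb k) * g x)%R
  (fun k => Z (s + h * qa k) (t + h * qb k)) b mA (measurable_exponent mf mg s t)
  (fun k => measurable_exponent mf mg _ _) (laplaceE Zoo t s0).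
have ck k := crit _ _ (qk k).
have sumZ (x : Rn R n) (a' b' : R) :
  (\sum_(i < n) (a' * f (tnth x i) + b' * g (tnth x i)) =
    a' * \sum_(i < n) f (tnth x i) + b' * \sum_(i < n) g (tnth x i) :> R)%R.
  by rewrite big_split/= !mulr_sumr.
move=> /(_ (fun k => laplaceE Zoo _ (ck k).1)).
move=> /(_ (fun x Ax => Ax.2)).
have n0 : (0 <= n%:R :> R)%R by [].
have nd0 : (0 <= n%:R * d)%R by rewrite mulr_ge0// ltW.
have HnA (x : Rn R n) : ~ A x -> exists k : 'I_4, (b k +
    \sum_(i < n) (s * f (tnth x i) + t * g (tnth x i)) <=
    \sum_(i < n) ((s + h * qa k) * f (tnth x i) +
                  (t + h * qb k) * g (tnth x i)))%R.
  move=> nAx.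
  have [k kP] : exists k, (n%:R * (qa k * u + qb k * v + d / 2) <=
      qa k * \sum_(i < n) f (tnth x i) + qb k * \sum_(i < n) g (tnth x i))%R.
    move: nAx; rewrite /A /level_set/= => /not_andP[/not_andP[]|].
    - by move=> /negP; rewrite -ltNge => fx; exists ord0; rewrite /qa /qb/=; lra.
    - move=> /negP; rewrite -ltNge ltr_normr => /orP[] gx.
        by exists (@Ordinal 4 1 isT); rewrite /qa /qb/=; lra.
      by exists (@Ordinal 4 2 isT); rewrite /qa /qb/=; lra.
    - move=> /negP; rewrite -ltNge sumZ => wx.
      by exists (@Ordinal 4 3 isT); rewrite /qa /qb/=; lra.
  exists k; rewrite !sumZ /b; have := ler_wpM2l (ltW h0) kP; lra.
have sumle : (\sum_(k < 4) expR (- b k) * Z (s + h * qa k) (t + h * qb k) ^+ n <=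
    Z s t ^+ n / 2)%R.
  (* The gap between d / 2 in [b] and d / 4 in the bounds on Z gives each direction the relative
     mass e^(-n h d / 4), eventually at most 1/8. *)
  apply: (@le_trans _ _ (\sum_(k < 4) Z s t ^+ n * (1 / 8))%R); last first.
    by rewrite sumr_const card_ord -mulr_natr; lra.
  apply: ler_sum => k _; have [sk Zk] := ck k.
  apply: (@le_trans _ _ (expR (- b k) *
      (Z s t * expR (h * (qa k * u + qb k * v + d / 4))) ^+ n)%R).
    rewrite ler_wpM2l ?expR_ge0// lerXn2r ?nnegrE ?mulr_ge0 ?expR_ge0 ?(ltW Zst)//.
    by rewrite ltW// Zgt0.
  rewrite exprMn -expRM_natl mulrCA ler_wpM2l ?exprn_ge0 ?(ltW Zst)//.
  rewrite -expRD [X in expR X](_ : _ = - (n%:R * (h * d / 4)))%R; last first.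
    by rewrite /b; field.
  by near: n; apply: near_expRN_le; rewrite ?divr_gt0 ?mulr_gt0.
move=> /(_ HnA) H.
have {H} : (Z s t ^+ n / 2)%:E <=
    (expR (n%:R * (s * u + t * v + d / 2)))%:E * lebesgue_n R n A.
  rewrite -(@leeD2rE _ (Z s t ^+ n / 2)%:E)// -EFinD -splitr.
  by apply: (le_trans H); rewrite leeD2l// lee_fin.
rewrite -lee_pdivrMl ?expR_gt0//; apply: le_trans.
rewrite -expRN -EFinM lee_fin.
rewrite -[X in (X ^+ n)%R]lnK ?posrE// -expRM_natl mulrA -expRD.
rewrite -ler_pdivrMl ?expR_gt0//.
rewrite -expRN -expRD.
have en : (expR (- (n%:R * (d / 2))) <= 2^-1)%R.
  by near: n; apply: near_expRN_le; rewrite ?invr_gt0.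
apply: le_trans en; rewrite ler_expR.
by have := ler_wpM2l n0 (Fj _ t s0); lra.
Unshelve. all: by end_near. Qed.

(** On [A] the exponent is at least s u + t v, because s < 0; restricting the integral to [A] bounds
    Z from below. This produces points (u, v) of finite cost. *)
Lemma laplace_set_ge (A : set R) (l s t u v : R) : measurable A -> (0 < l)%R ->
  lebesgue_measure A = l%:E -> (s < 0)%R ->
  (forall x, A x -> (f x <= u)%R) -> (forall x, A x -> (t * v <= t * g x)%R) ->
  (s * u + t * v - ln (Z s t) <= - ln l)%R.
Proof.
move=> mA l0 Al s0 fu gv.
have : l%:E * (expR (s * u + t * v))%:E <= (Z s t)%:E.
  rewrite -Al muleC -integral_cst// -(laplaceE Zoo t s0).
  apply: (@le_trans _ _
      (\int[lebesgue_measure]_(x in A) (expR (s * f x + t * g x))%:E)).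
    apply: ge0_le_integral => //=.
    - by apply: measurable_funTS; exact: measurable_tilt.
    - by move=> x Ax; rewrite lee_fin ler_expR lerD ?gv// ler_wnM2l ?fu// ltW.
  by apply: ge0_subset_integral => //=; exact: measurable_tilt.
rewrite -EFinM lee_fin => lZ.
rewrite -[X in (X - _)%R]expRK.
have : (ln (l * expR (s * u + t * v)) <= ln (Z s t))%R.
  by rewrite ler_ln ?posrE ?mulr_gt0 ?expR_gt0// (laplace_gt0 mf mg Zoo).
by rewrite lnM ?posrE ?expR_gt0//; lra.
Qed.

(* The cost is convex in (u, v), so any admissible point with u < 1 lets us
   move slightly inside the boundary u = 1. *)
Lemma level_set_ge1 (v j u0 v0 j0 d : R) : (0 < d)%R -> (u0 < 1)%R ->
  (forall s t : R, s < 0 -> s * u0 + t * v0 - ln (Z s t) <= j0)%R ->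
  (forall s t : R, s < 0 -> s + t * v - ln (Z s t) <= j)%R ->
  \forall n \near \oo,
    (expR (- (n%:R * (j + d))))%:E <= lebesgue_n R n (level_set n 1 v d).
Proof.
move=> d0 u01 j0P jP.
pose K := (1 + `|v0 - v| + `|j0 - j|)%R.
have K0 : (0 < K)%R by rewrite /K -addrA ltr_pwDl// addr_ge0.
(* [r] is the weight of the point (u0, v0). As [K] exceeds both |v0 - v| and |j0 - j|, the mixture
   moves the target and the cost by at most d / 2. *)
pose r := Num.min (1 / 2)%R (d / (2 * K))%R.
have r0 : (0 < r)%R by rewrite /r lt_min !divr_gt0// mulr_gt0.
have r2 : (r <= 1 / 2)%R by rewrite /r ge_min lexx.
have rK : (r * K <= d / 2)%R.
  have : (r <= d / (2 * K))%R by rewrite /r ge_min lexx orbT.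
  by rewrite ler_pdivlMr ?mulr_gt0//; lra.
have rv : (`|r * (v0 - v)| <= d / 2)%R.
  rewrite normrM (gtr0_norm r0); apply: le_trans rK.
  rewrite ler_wpM2l ?(ltW r0)// /K.
  by have := normr_ge0 (j0 - j)%R; set x := `|_ - _|%R; set y := `|_ - _|%R; lra.
have rj : (r * (j0 - j) <= d / 2)%R.
  apply: le_trans rK; rewrite ler_wpM2l ?(ltW r0)// /K.
  by have := ler_norm (j0 - j)%R; have := normr_ge0 (v0 - v)%R; lra.
(* The first bound keeps the enlarged level 1 - r + r u0 + e at most 1. *)
pose e := Num.min (r * (1 - u0))%R (d / 2)%R.
have e0 : (0 < e)%R by rewrite /e lt_min mulr_gt0 ?subr_gt0 ?divr_gt0.
have eu : (e <= r * (1 - u0))%R by rewrite /e ge_min lexx.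
have ed : (e <= d / 2)%R by rewrite /e ge_min lexx orbT.
have rP (s t : R) : (s < 0 -> s * (1 - r + r * u0) + t * (v + r * (v0 - v)) -
    ln (Z s t) <= j + r * (j0 - j))%R.
  move=> s0.
  have h1 := ler_wpM2l (ltW r0) (j0P s t s0).
  have r1 : (0 <= 1 - r)%R by lra.
  by have := ler_wpM2l r1 (jP s t s0); lra.
have := level_set_ge e0 rP; apply: filterS => n nP.
have n0 : (0 <= n%:R :> R)%R by [].
apply: le_trans (le_trans nP _).
  by rewrite lee_fin ler_expR lerN2 ler_wpM2l//; lra.
apply: le_measure; rewrite ?inE; try exact: measurable_level_set.
move=> x [fx gx]; split.
  by apply: (le_trans fx); rewrite ler_wpM2l//; lra.
apply: (@le_trans _ _ (n%:R * e + n%:R * (d / 2)))%R; last first.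
  by rewrite -mulrDr ler_wpM2l//; lra.
have -> : (\sum_(i < n) g (tnth x i) - n%:R * v =
  \sum_(i < n) g (tnth x i) - n%:R * (v + r * (v0 - v)) +
  n%:R * (r * (v0 - v)))%R by lra.
by rewrite (le_trans (ler_normD _ _))// lerD// normrM ger0_norm// ler_wpM2l.
Qed.

End tilted_lower_bound.

(** * Orlicz functions *)

Section orlicz_laplace.
Context (R : realType) (V : R -> R).
Hypothesis oV : orlicz (EFin \o V).

Lemma orlicz_ge0 x : (0 <= V x)%R.
Proof. by have [_ _ /(_ x) + _] := oV; rewrite lee_fin. Qed.

Lemma orlicz_scale_le (t x : R) : (0 <= t <= 1)%R -> (V (t * x) <= t * V x)%R.
Proof.
move=> t01; have [/(_ t 0%R x t01)/= + _ _ [V0]] := oV.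
by rewrite mulr0 add0r V0 mule0 add0e -EFinM lee_fin.
Qed.

Lemma orlicz_nondecreasing (x y : R) : (0 <= x <= y)%R -> (V x <= V y)%R.
Proof.
move=> /andP[x0 xy]; have [y0|y0] := eqVneq y 0%R.
  by have -> : x = y by apply/eqP; rewrite eq_le xy y0.
have {}y0 : (0 < y)%R by rewrite lt0r y0 (le_trans x0).
have t01 : (0 <= x / y <= 1)%R by rewrite divr_ge0 ?(ltW y0)//= ler_pdivrMr// mul1r.
have := orlicz_scale_le y t01; rewrite divfK ?gt_eqF// => /le_trans; apply.
by rewrite ler_piMl ?orlicz_ge0//; case/andP : t01.
Qed.

Lemma orlicz_norm (x : R) : V `|x| = V x.
Proof.
by have [_ /(_ x)/= [Vx] _ _] := oV; have [] := ler0P x.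
Qed.

Lemma orlicz_measurable : measurable_fun setT V.
Proof.
(* Truncation at 0 makes the outer function nondecreasing on the whole line, hence measurable. *)
have -> : V = (fun y => V (Num.max 0 y)%R) \o (fun x => `|x|)%R.
  by apply/funext => x /=; rewrite max_r// orlicz_norm.
apply: measurableT_comp; last exact: normr_measurable.
apply: nondecreasing_measurable => // x y xy; apply: orlicz_nondecreasing.
by rewrite le_max lexx/= ge_max !le_max lexx xy orbT.
Qed.

Lemma orlicz_small : exists2 a : R, (0 < a)%R & (V a <= 1 / 2)%R.
Proof.
have V1 := orlicz_ge0 1.
have a0 : (0 < (2 * (1 + V 1))^-1)%R by rewrite invr_gt0 mulr_gt0//; lra.
exists (2 * (1 + V 1))^-1%R => //.
rewrite -[X in V X]mulr1; apply: (le_trans (orlicz_scale_le _ _)).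
  by rewrite ltW//= invf_le1 ?mulr_gt0//; lra.
by rewrite mulrC ler_pdivrMr ?mulr_gt0//; lra.
Qed.

Hypothesis sV : superquadratic (EFin \o V).

Lemma superquadratic_ge (K : R) : exists2 r : R, (0 < r)%R &
  forall x, (r <= `|x| -> K * x ^+ 2 <= V x)%R.
Proof.
have /cvgeyPge/(_ K) [M [_ MK]] := sV.
exists (Num.max 1 (M + 1))%R; first by rewrite lt_max ltr01.
move=> x; rewrite ge_max => /andP[x1 xM].
have x2 : (0 < x ^+ 2)%R by rewrite -real_normK ?num_real// exprn_gt0//; lra.
have := MK `|x|%R; rewrite real_normK ?num_real//= orlicz_norm.
rewrite inver gt_eqF// -EFinM lee_fin ler_pdivlMr//; apply; lra.
Qed.

(** Domination by a multiple of e^(-x^2): for |x| > r superquadratic growth gives s V(x) + t x^2 <=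
    -x^2, and for |x| <= r the constant [C] compensates. *)
Lemma orlicz_laplace_lty (s t : R) : (s < 0)%R ->
  \int[lebesgue_measure]_x (expR (s * V x + t * x ^+ 2))%:E < +oo.
Proof.
move=> s0; have [r r0 rV] := superquadratic_ge ((`|t| + 1) / - s).
pose C := expR ((`|t| + 1) * r ^+ 2).
apply: (@le_lt_trans _ _
    (\int[lebesgue_measure]_x (C%:E * (gauss_fun x)%:E))); last first.
  rewrite ge0_integralZl ?lee_fin ?expR_ge0//.
  - by rewrite integralT_gauss -EFinM ltry.
  - by apply/measurable_EFinP; exact: measurable_gauss_fun.
  - by move=> x _; rewrite lee_fin gauss_fun_ge0.
apply: ge0_le_integral => //.
- apply/measurable_EFinP; apply: measurableT_comp => //.
  apply: measurable_funD; apply: measurable_funM; try exact: measurable_cst.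
    exact: orlicz_measurable.
  exact: measurable_funX.
- apply: measurable_funeM; apply/measurable_EFinP; exact: measurable_gauss_fun.
move=> x _; rewrite -EFinM lee_fin /C /gauss_fun -expRD ler_expR.
have tx : (t * x ^+ 2 <= `|t| * x ^+ 2)%R by rewrite ler_wpM2r ?sqr_ge0// ler_norm.
have t1 : (0 <= `|t| + 1)%R by rewrite addr_ge0.
have [xr|xr] := leP `|x|%R r.
  have x2 : (x ^+ 2 <= r ^+ 2)%R.
    by rewrite -(real_normK (num_real x)) ler_sqr ?nnegrE// ltW.
  have := ler_wpM2l t1 x2; have := mulr_le0_ge0 (ltW s0) (orlicz_ge0 x); lra.
have := rV x (ltW xr); rewrite mulrAC ler_pdivrMr ?oppr_gt0// => Vx.
have := mulr_ge0 t1 (sqr_ge0 r); lra.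
Qed.

End orlicz_laplace.

(** * The rate function on the half-line *)

Section nonnegative_half_line.
Context (R : realType).
Local Notation Rp := (set_type (@Rplus R)).

Lemma Rplus_val_ge0 (z : Rp) : (0 <= set_val z)%R.
Proof. by have := set_valP z; rewrite /Rplus/= in_itv/= andbT. Qed.

Lemma Rplus_regular : regular_space Rp.
Proof. exact: uniform_regular. Qed.

Lemma continuous_Rplus_val : continuous (set_val : Rp -> R).
Proof. exact: initial_continuous. Qed.

Lemma max0_Rplus (r : R) : Num.max 0%R r \in @Rplus R.
Proof. by rewrite inE /Rplus/= in_itv/= andbT le_max lexx. Qed.

(** A continuous retraction onto the half-line, through which compactness of segments is
    inherited. *)
Definition to_Rplus (r : R) : Rp :=
  exist (fun x => x \in @Rplus R) (Num.max 0%R r) (max0_Rplus r).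

Lemma continuous_to_Rplus : continuous to_Rplus.
Proof.
apply: continuous_comp_initial => r.
have -> : set_val \o to_Rplus = (cst 0%R : R -> R) \max id.
  by apply/funext => x; rewrite /= set_valE.
by apply: continuous_max; [exact: cvg_cst|exact: cvg_id].
Qed.

Lemma compact_Rplus_le (b : R) : compact [set z : Rp | (set_val z <= b)%R].
Proof.
have -> : [set z : Rp | (set_val z <= b)%R] = to_Rplus @` `[0%R, b]%classic.
  apply/seteqP; split => [z /= zb|_ [r /= + <-]].
    exists (set_val z); first by rewrite in_itv/= Rplus_val_ge0.
    by apply: val_inj => /=; rewrite max_r// Rplus_val_ge0.
  by rewrite in_itv/= => /andP[r0 rb]; rewrite set_valE/= max_r.
apply: continuous_compact; last exact: segment_compact.
by apply: continuous_subspaceT; exact: continuous_to_Rplus.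
Qed.

(** Neighbourhoods are expressed through squares, since level sets control the sum of squares. For
    a, b >= 0 one has |a - b|^2 <= |a^2 - b^2|. *)
Lemma nbhs_Rplus_sqr (z : Rp) (G : set Rp) : nbhs z G ->
  exists2 e : R, (0 < e)%R &
    forall y : Rp, (`|set_val y ^+ 2 - set_val z ^+ 2| <= e)%R -> G y.
Proof.
rewrite nbhsE => -[U [[W oW <-] /= Wz] sG].
have /nbhs_ballP[r /= r0 rW] : nbhs (set_val z) W by exact: open_nbhs_nbhs.
exists (r ^+ 2 / 4)%R; first by rewrite divr_gt0// exprn_gt0.
move=> y yz; apply: sG; apply: rW; rewrite /ball/=.
have := Rplus_val_ge0 y; have := Rplus_val_ge0 z; move: yz.
rewrite -(@ltr_pXn2r _ 2%N) ?nnegrE ?(ltW r0)// real_normK ?num_real// ler_norml.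
set a := set_val y; set b := set_val z => /andP[h1 h2] b0 a0.
have r2 : (0 < r ^+ 2)%R by rewrite exprn_gt0.
by have [ab|ba] := leP a b; nra.
Qed.

Lemma measurable_scaled_norm n (G : set Rp) : borel G ->
  measurable (@scaled_norm R n @^-1` G).
Proof.
have mnorm : measurable_fun setT (fun x : Rn R n => l2norm x / Num.sqrt n%:R)%R.
  apply: measurable_funM; last exact: measurable_cst.
  apply: (measurableT_comp (continuous_measurable_fun (@sqrt_continuous R))).
  exact: (@measurable_sum_tnth R n (fun x => x ^+ 2)%R (measurable_funX _ _)).
move: G; apply: smallest_sub.
  split.
  - by rewrite /= preimage_set0.
  - move=> A /= mA; rewrite setTD preimage_setC; exact: measurableC.
  - by move=> F /= mF; rewrite preimage_bigcup; exact: bigcup_measurable.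
move=> _ [U oU <-] /=.
rewrite -comp_preimage -[X in measurable X]setTI; apply: mnorm => //.
exact: open_measurable.
Qed.

End nonnegative_half_line.

Section orlicz_rate_function.
Context (R : realType) (V : R -> R).
Hypotheses (oV : orlicz (EFin \o V)) (sV : superquadratic (EFin \o V)).
Local Notation Rp := (set_type (@Rplus R)).

Let sq (x : R) : R := (x ^+ 2)%R.
Let mV : measurable_fun setT V := orlicz_measurable oV.
Let msq : measurable_fun setT sq.
Proof. exact: measurable_funX. Qed.
Let Zoo (s t : R) : (s < 0)%R ->
  \int[lebesgue_measure]_x (expR (s * V x + t * sq x))%:E < +oo.
Proof. exact: orlicz_laplace_lty. Qed.

Definition log_laplace (s t : R) : R := ln (laplace V sq s t).
Local Notation L := log_laplace.

Lemma lne_orlicz_laplace (s t : R) : (s < 0)%R ->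
  lne (\int[lebesgue_measure]_x (expR (s * V x + t * x ^+ 2))%:E) = (L s t)%:E.
Proof.
move=> s0; rewrite (laplaceE Zoo t s0) lne_EFin//.
exact: laplace_gt0 mV msq Zoo _ _ s0.
Qed.

Lemma lne_orlicz_laplace0 (s : R) : (s < 0)%R ->
  lne (\int[lebesgue_measure]_x (expR (s * V x))%:E) = (L s 0)%:E.
Proof.
move=> s0; rewrite -lne_orlicz_laplace//; congr lne.
by apply: eq_integral => x _; rewrite mul0r addr0.
Qed.

Lemma calJ_le (v j : R) : calJ V 1 v <= j%:E <->
  forall s t : R, (s < 0)%R -> (s + t * v - L s t <= j)%R.
Proof.
split=> [/ereal_supP H s t s0|H].
  rewrite -lee_fin; apply: H; exists s => //; exists t => //.
  by rewrite lne_orlicz_laplace// mulr1.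
apply: ge_ereal_sup => _ [s /= s0 [t _ <-]].
by rewrite lne_orlicz_laplace// -EFinB lee_fin mulr1 H.
Qed.

Lemma calJ_gt (v c : R) : c%:E < calJ V 1 v ->
  exists s t : R, (s < 0)%R /\ (c < s + t * v - L s t)%R.
Proof.
move=> /ereal_sup_gt[_ [s /= s0 [t _ <-]]].
rewrite lne_orlicz_laplace// -EFinB lte_fin mulr1 => cst.
by exists s, t.
Qed.

Lemma calJ_ge (v s t : R) : (s < 0)%R -> (s + t * v - L s t)%:E <= calJ V 1 v.
Proof.
move=> s0; apply: ereal_sup_ubound; exists s => //; exists t => //.
by rewrite lne_orlicz_laplace// mulr1.
Qed.

(** V is at most 1/2 on [0, a]. With b = a / 2, the intervals [b, a] (for t >= 0) and [0, b] (for t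
    < 0) have length b and lie on the correct side of x^2 = b^2, so (1/2, b^2) has cost at most -ln
    b. The last clause, t = 0, serves the volume of the ball. *)
Lemma orlicz_interior_point : exists u0 v0 j0 : R, [/\ (u0 < 1)%R,
  (forall s t : R, s < 0 -> s * u0 + t * v0 - L s t <= j0)%R &
  (forall s : R, s < 0 -> s * u0 - L s 0 <= j0)%R].
Proof.
have [a a0 Va] := orlicz_small oV.
pose b := (a / 2)%R; have b0 : (0 < b)%R by rewrite divr_gt0.
exists (1 / 2)%R, (b ^+ 2)%R, (- ln b)%R.
have key (s t : R) : (s < 0 -> s * (1 / 2) + t * b ^+ 2 - L s t <= - ln b)%R.
  move=> s0; have [t0|t0] := leP 0%R t.
    apply: (laplace_set_ge mV msq Zoo (A := `[b, a]%classic)) => //.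
    - rewrite lebesgue_measure_itv/= lte_fin ifT; last by rewrite /b; lra.
      by rewrite -EFinB; congr EFin; rewrite /b; lra.
    - move=> x /=; rewrite in_itv/= => /andP[bx xa]; apply: le_trans Va.
      by apply: orlicz_nondecreasing; rewrite ?xa// ?(le_trans (ltW b0)).
    - move=> x /=; rewrite in_itv/= => /andP[bx xa]; rewrite ler_wpM2l//.
      by rewrite ler_sqr ?nnegrE ?(ltW b0)// (le_trans (ltW b0)).
  apply: (laplace_set_ge mV msq Zoo (A := `[0%R, b]%classic)) => //.
  - by rewrite lebesgue_measure_itv/= lte_fin b0 -EFinB subr0.
  - move=> x /=; rewrite in_itv/= => /andP[x0 xb]; apply: le_trans Va.
    by apply: orlicz_nondecreasing; rewrite ?x0//= (le_trans xb)// /b; lra.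
  - move=> x /=; rewrite in_itv/= => /andP[x0 xb].
    by rewrite ler_wnM2l ?(ltW t0)// ler_sqr ?nnegrE ?(ltW b0).
split; [by lra|exact: key|].
by move=> s s0; have := key s 0%R s0; rewrite mul0r addr0.
Qed.

(** The supremum subtracted in [JX], as a real number: the volume of the [V]-ball in dimension n is
    e^(-n J0) up to subexponential factors. *)
Definition volume_rate : R :=
  sup [set (s - L s 0)%R | s in [set s : R | (s < 0)%R]].
Local Notation J0 := volume_rate.

Let has_sup_volume_rate :
  has_sup [set (s - L s 0)%R | s in [set s : R | (s < 0)%R]].
Proof.
split; first by exists (-1 - L (-1) 0)%R; exists (-1)%R => //=; exact: ltrN10.
have [u0 [v0 [j0 [u01 _ j0P]]]] := orlicz_interior_point.
exists j0 => _ [s /= s0 <-]; apply: le_trans (j0P _ s0).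
by rewrite lerD2r; nra.
Qed.

Lemma volume_rate_ge (s : R) : (s < 0)%R -> (s - L s 0 <= J0)%R.
Proof. by move=> s0; apply: ub_le_sup; [case: has_sup_volume_rate|exists s]. Qed.

Lemma volume_rate_adherent (e : R) : (0 < e)%R ->
  exists2 s : R, (s < 0)%R & (J0 - e < s - L s 0)%R.
Proof.
by move=> /sup_adherent/(_ has_sup_volume_rate)[_ [s /= s0 <-] ?]; exists s.
Qed.

Lemma volume_rateE :
  ereal_sup [set s%:E - lne (\int[lebesgue_measure]_x (expR (s * V x))%:E)
    | s in [set s : R | (s < 0)%R]] = J0%:E.
Proof.
have [ne ub] := has_sup_volume_rate.
rewrite -(ereal_sup_EFin ub ne); congr ereal_sup.
apply/seteqP; split => [_ [s /= s0 <-]|_ [_ [s /= s0 <-] <-]].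
  by exists (s - L s 0)%R; [exists s|rewrite lne_orlicz_laplace0].
by exists s => //; rewrite lne_orlicz_laplace0.
Qed.

Lemma JXE (z : Rp) : JX V z = calJ V 1 (set_val z ^+ 2) - J0%:E.
Proof. by rewrite /JX volume_rateE. Qed.

Lemma JX_gt (z : Rp) (c : R) : c%:E < JX V z <->
  (c + J0)%:E < calJ V 1 (set_val z ^+ 2).
Proof. by split; rewrite JXE lteBrDr. Qed.

Lemma JX_le (z : Rp) (c : R) : JX V z <= c%:E <->
  calJ V 1 (set_val z ^+ 2) <= (c + J0)%:E.
Proof. by split; rewrite JXE leeBlDr. Qed.

Lemma open_cost_gt (s t c : R) :
  open [set x : R | (c < s + t * x ^+ 2 - L s t)%R].
Proof.
have cp : continuous (fun x : R => s + t * x ^+ 2 - L s t)%R.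
  move=> x; apply: cvgB; last exact: cvg_cst.
  apply: cvgD; first exact: cvg_cst; apply: cvgM; first exact: cvg_cst.
  exact: exprn_continuous.
by move/continuousP : cp => /(_ _ (@open_gt _ c)).
Qed.

Lemma open_Rplus_cost_gt (s t c : R) :
  open [set y : Rp | (c < s + t * set_val y ^+ 2 - L s t)%R].
Proof.
by have /continuousP/(_ _ (@open_cost_gt s t c)) := @continuous_Rplus_val R.
Qed.

(** Up to a constant, [JX] is a supremum of functions continuous in z. *)
Lemma JX_lower_semicontinuous : lower_semicontinuous (JX V).
Proof.
move=> z c /JX_gt/calJ_gt[s [t [s0 cst]]].
exists [set y : Rp | (c + J0 < s + t * set_val y ^+ 2 - L s t)%R].
  by apply: open_nbhs_nbhs; split => //; exact: open_Rplus_cost_gt.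
by move=> y /= cy; apply/JX_gt; apply: lt_le_trans (calJ_ge _ t s0).
Qed.

Lemma JX_ge0 (z : Rp) : 0 <= JX V z.
Proof.
rewrite JXE sube_ge0// -volume_rateE; apply: ge_ereal_sup => _ [s /= s0 <-].
rewrite lne_orlicz_laplace0// -EFinB.
by apply: le_trans (calJ_ge _ 0%R s0); rewrite mul0r addr0.
Qed.

Lemma JX_good_rate_function : good_rate_function (JX V).
Proof.
split; first by split; [exact: JX_ge0|exact: JX_lower_semicontinuous].
(* The pair s = -1, t = 1 bounds z^2 by a + J0 + 1 + L (-1) 1 on the sublevel set, and z <= 1 +
   z^2. *)
move=> a; pose b : R := (1 + (a + J0 + 1 + L (-1) 1))%R.
apply: (subclosed_compact _ (@compact_Rplus_le R b)).
  have -> : [set z | JX V z <= a%:E] = ~` [set z | a%:E < JX V z].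
    by apply/seteqP; split=> z /=; rewrite leNgt => /negP.
  apply: open_closedC; move: a @b.
  exact/lower_semicontinuousP/JX_lower_semicontinuous.
move=> z /= /JX_le/calJ_le => /(_ (-1)%R 1%R (ltrN10 R)).
by rewrite mul1r /b; have := sqr_ge0 (set_val z - 1 / 2)%R; lra.
Qed.

End orlicz_rate_function.

(** * Volumes of slices of Orlicz balls *)

Section orlicz_ball_volume.
Context (R : realType).
Local Notation Rp := (set_type (@Rplus R)).

Lemma measurable_orlicz_ball n (W : nat -> R -> R) :
  (forall i, orlicz (EFin \o W i)) -> measurable (orlicz_ball n W).
Proof.
move=> oW; apply: measurable_le_fun; last exact: measurable_cst.
apply: measurable_sum => i; apply: measurableT_comp; last exact: measurable_tnth.
exact: orlicz_measurable.
Qed.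

Lemma scaled_norm_sqr n (x : Rn R n) :
  (set_val (scaled_norm x) ^+ 2 = (\sum_(i < n) (tnth x i : R) ^+ 2) / n%:R)%R.
Proof.
rewrite set_valE/= /l2norm expr_div_n !sqr_sqrtr//.
by apply: sumr_ge0 => i _; exact: sqr_ge0.
Qed.

Variable V : R -> R.
Hypotheses (oV : orlicz (EFin \o V)) (sV : superquadratic (EFin \o V)).
Local Notation L := (log_laplace V).
Local Notation J0 := (volume_rate V).
Local Notation ball n := (orlicz_ball n (fun=> V)).

Let sq (x : R) : R := (x ^+ 2)%R.
Let mV : measurable_fun setT V := orlicz_measurable oV.
Let msq : measurable_fun setT sq.
Proof. exact: measurable_funX. Qed.
Let Zoo (s t : R) : (s < 0)%R ->
  \int[lebesgue_measure]_x (expR (s * V x + t * sq x))%:E < +oo.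
Proof. exact: orlicz_laplace_lty. Qed.
Let mball n : measurable (ball n).
Proof. by apply: measurable_orlicz_ball. Qed.

(** On the ball the sum of V is at most the dimension, so for s < 0 the exponent is at least the
    dimension times s + t z^2, z being the scaled norm; Chebyshev then applies. *)
Lemma orlicz_ball_exp_le n (A : set (Rn R n.+1)) (s t c : R) :
  measurable A -> A `<=` ball n.+1 -> (s < 0)%R ->
  (forall x, A x -> (c <= s + t * set_val (scaled_norm x) ^+ 2 - L s t)%R) ->
  lebesgue_n R n.+1 A <= (expR (- (n.+1%:R * c)))%:E.
Proof.
move=> mA AB s0 Ac.
have Z0 : (0 < laplace V sq s t)%R := laplace_gt0 mV msq Zoo t s0.
apply: le_trans (lebesgue_n_exp_le (c := (n.+1%:R * (c + L s t))%R) mA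
  (measurable_exponent mV msq s t) (laplaceE Zoo t s0) _) _; last first.
  rewrite -[X in (X ^+ _)%R]lnK ?posrE// -expRM_natl -expRD lee_fin ler_expR.
  by rewrite /L -/sq; set l := ln _; lra.
move=> x Ax; rewrite big_split/= -!mulr_sumr.
have n0 : (0 < n.+1%:R :> R)%R by [].
apply: (@le_trans _ _ (n.+1%:R * (s + t * set_val (scaled_norm x) ^+ 2)))%R.
  by rewrite ler_wpM2l ?(ltW n0)//; have := Ac x Ax; lra.
rewrite scaled_norm_sqr mulrDr lerD//.
  by rewrite mulrC ler_wnM2l ?(ltW s0)//; exact: AB.
by rewrite mulrCA [X in (_ * X)%R]mulrC divfK ?gt_eqF.
Qed.

Lemma orlicz_ball_volume_le (e : R) n : (0 < e)%R ->
  lebesgue_n R n.+1 (ball n.+1) <= (expR (- (n.+1%:R * (J0 - e))))%:E.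
Proof.
move=> /(volume_rate_adherent oV sV)[s s0 /ltW Js].
apply: (@orlicz_ball_exp_le n _ s 0%R) => // x _.
by rewrite mul0r addr0.
Qed.

Lemma orlicz_ball_volume_ge (e : R) : (0 < e)%R -> \forall n \near \oo,
  (expR (- (n%:R * (J0 + e))))%:E <= lebesgue_n R n (ball n).
Proof.
move=> e0; have [u0 [v0 [j0 [u01 _ j0P]]]] := orlicz_interior_point oV sV.
have LE (s : R) t : ln (laplace V (cst 0%R) s t) = L s 0.
  congr (ln (fine _)); apply: eq_integral => x _.
  by rewrite /= mulr0 mul0r.
have Zoo0 (s t : R) : (s < 0)%R ->
    \int[lebesgue_measure]_x (expR (s * V x + t * (cst 0%R x)))%:E < +oo.
  move=> s0; apply: le_lt_trans (Zoo 0%R s0); rewrite le_eqVlt; apply/orP; left.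
  by apply/eqP; apply: eq_integral => x _; rewrite /= mulr0 mul0r.
(* With g = 0 and v = 0 the level set lies in the ball, and t disappears from the cost. *)
have := @level_set_ge1 R V (cst 0%R) mV (measurable_cst _) (orlicz_ge0 oV)
  (fun=> lexx _) Zoo0 0%R J0 u0 0%R j0 e e0 u01.
have H1 (s t : R) : (s < 0 -> s * u0 + t * 0 - ln (laplace V (cst 0) s t) <= j0)%R.
  by move=> s0; rewrite LE mulr0 addr0 j0P.
have H2 (s t : R) : (s < 0 -> s + t * 0 - ln (laplace V (cst 0) s t) <= J0)%R.
  by move=> s0; rewrite LE mulr0 addr0 volume_rate_ge.
move=> /(_ H1 H2); apply: filterS => n /le_trans; apply.
apply: le_measure; rewrite ?inE.
- by apply: measurable_level_set => //; exact: measurable_cst.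
- exact: mball.
by move=> x [fx _]; move: fx; rewrite mulr1.
Qed.

Lemma orlicz_ball_open_ge (G : set Rp) (z : Rp) (j e : R) : borel G -> G° z ->
  (0 < e)%R -> calJ V 1 (set_val z ^+ 2) <= j%:E -> \forall n \near \oo,
  (expR (- (n.+1%:R * (j + e))))%:E <=
    lebesgue_n R n.+1 (@scaled_norm R n.+1 @^-1` G `&` ball n.+1).
Proof.
move=> bG zG e0 /(calJ_le oV sV) jP.
have [u0 [v0 [j0 [u01 j0P _]]]] := orlicz_interior_point oV sV.
have [r r0 rG] := nbhs_Rplus_sqr zG.
pose d := Num.min r e.
have d0 : (0 < d)%R by rewrite lt_min r0.
have := level_set_ge1 mV msq (orlicz_ge0 oV) (fun x => sqr_ge0 x) Zoo d0 u01 j0P jP.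
move=> [N _ NP]; exists N => // n /= Nn.
have n0 : (0 < n.+1%:R :> R)%R by [].
apply: le_trans (le_trans (NP n.+1 (leqW Nn)) _).
  by rewrite lee_fin ler_expR lerN2 ler_wpM2l ?(ltW n0)// lerD2l ge_min lexx orbT.
apply: le_measure; rewrite ?inE.
- exact: measurable_level_set.
- by apply: measurableI; [exact: measurable_scaled_norm|exact: mball].
move=> x [fx gx]; split; last by move: fx; rewrite mulr1.
apply: rG; rewrite scaled_norm_sqr.
rewrite -(@ler_pM2l _ n.+1%:R)// -{1}(gtr0_norm n0) -normrM mulrBr mulrCA.
rewrite divff ?gt_eqF// mulr1; apply: (le_trans gx).
by rewrite ler_wpM2l ?(ltW n0)// ge_min lexx.
Qed.

(** Union bound by induction on the list: the part of [G] where the first pair has cost above [c] is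
    handled by Chebyshev, the rest by the remaining pairs. *)
Lemma orlicz_ball_finite_cover_le n (c : R) (l : seq (R * R)) (G : set Rp) :
  measurable (@scaled_norm R n.+1 @^-1` G) ->
  (forall p, p \in l -> (p.1 < 0)%R) ->
  (forall z, G z -> exists2 p, p \in l &
    (c < p.1 + p.2 * set_val z ^+ 2 - L p.1 p.2)%R) ->
  lebesgue_n R n.+1 (@scaled_norm R n.+1 @^-1` G `&` ball n.+1) <=
    ((size l)%:R * expR (- (n.+1%:R * c)))%:E.
Proof.
elim: l G => [|p l ih] G mG l0 lG.
  rewrite mul0r (_ : _ `&` _ = set0) ?measure0//.
  by apply/seteqP; split => // x [/lG[]].
pose H := [set z : Rp | (c < p.1 + p.2 * set_val z ^+ 2 - L p.1 p.2)%R].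
have mH : measurable (@scaled_norm R n.+1 @^-1` H).
  apply: measurable_scaled_norm; apply: sub_sigma_algebra.
  exact: open_Rplus_cost_gt.
have -> : @scaled_norm R n.+1 @^-1` G `&` ball n.+1 =
   (@scaled_norm R n.+1 @^-1` G `&` ball n.+1 `&` @scaled_norm R n.+1 @^-1` H) `|`
   (@scaled_norm R n.+1 @^-1` (G `\` H) `&` ball n.+1).
  apply/seteqP; split=> [x [Gx Bx]|x [[[]]|[[]]]]//.
  by have [Hx|Hx] := pselect (H (scaled_norm x)); [left|right].
have mGH : measurable (@scaled_norm R n.+1 @^-1` (G `\` H)) by exact: measurableD.
apply: le_trans (measureU2 _ _ _) _.
- by apply: measurableI => //; apply: measurableI => //; exact: mball.
- by apply: measurableI => //; exact: mball.
rewrite [size _]/= (_ : (size l).+1%:R = 1 + (size l)%:R :> R)%R; last first.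
  by rewrite -natr1 addrC.
rewrite mulrDl mul1r EFinD; apply: leeD.
  apply: (@orlicz_ball_exp_le n _ p.1 p.2).
  - by apply: measurableI => //; apply: measurableI => //; exact: mball.
  - by move=> x [[]].
  - by apply: l0; rewrite mem_head.
  - by move=> x [_ /ltW].
apply: ih => //.
- by move=> q ql; apply: l0; rewrite in_cons ql orbT.
- move=> z [/lG[q]]; rewrite in_cons => /predU1P[->//|ql cq _].
  by exists q.
Qed.

Lemma orlicz_ball_closed_le (G : set Rp) (c : R) : borel G ->
  (forall z, closure G z -> c%:E < calJ V 1 (set_val z ^+ 2)) ->
  exists K : R, forall n,
    lebesgue_n R n.+1 (@scaled_norm R n.+1 @^-1` G `&` ball n.+1) <=
      (K * expR (- (n.+1%:R * c)))%:E.
Proof.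
move=> bG Gc.
(* Beyond [b] the single pair (-1, 1) already has cost above [c], so a compact part of the closure
   remains to be covered. *)
pose b : R := (2 + `|c + 1 + L (-1) 1|)%R.
have cG : compact (closure G `&` [set z : Rp | (set_val z <= b)%R]).
  rewrite setIC; apply: compact_closedI; first exact: compact_Rplus_le.
  exact: closed_closure.
(* Covers are taken in [R], as [compact_cover] needs a pointed space. *)
have : compact (set_val @` (closure G `&` [set z : Rp | (set_val z <= b)%R])).
  apply: continuous_compact => //; apply: continuous_subspaceT.
  exact: continuous_Rplus_val.
rewrite compact_cover => /(_ _ [set p : R * R | (p.1 < 0)%R]
  (fun p => [set x : R | (c < p.1 + p.2 * x ^+ 2 - L p.1 p.2)%R])).
case.
- by move=> p _; exact: open_cost_gt.
- move=> _ [z [/Gc/(calJ_gt oV sV)[s [t [s0 cst]]] _] <-].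
  by exists (s, t).
move=> D D0 DG; exists (size ((-1, 1)%R :: finmap.enum_fset D))%:R => n.
apply: orlicz_ball_finite_cover_le.
- exact: measurable_scaled_norm.
- move=> p; rewrite in_cons => /predU1P[->|/D0]; first exact: ltrN10.
  by rewrite inE.
- move=> z Gz; have [zb|zb] := leP (set_val z) b.
    have [|p pD pz] := DG (set_val z).
      by exists z => //; split => //; exact: subset_closure.
    by exists p => //; rewrite in_cons; apply/orP; right.
  exists (-1, 1)%R; first by rewrite mem_head.
  rewrite /= mul1r; move: zb; rewrite /b; have := ler_norm (c + 1 + L (-1) 1)%R.
  by have := sqr_ge0 (set_val z - 1 / 2)%R; lra.
Qed.

End orlicz_ball_volume.

(** * Passage to the uniform law *)

Section exponential_rates.
Context (R : realType).
Implicit Types (u : (\bar R)^nat) (l : R).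

Lemma limn_esup_le_near u l : (\forall n \near \oo, u n <= l%:E) ->
  limn_esup u <= l%:E.
Proof.
move=> ul; rewrite /limn_esup limf_esupE.
apply: (@le_trans _ _ (ereal_sup (u @` [set n | u n <= l%:E]))).
  by apply: ereal_inf_lbound; exists [set n | u n <= l%:E].
by apply: ge_ereal_sup => _ [n /= ? <-].
Qed.

Lemma limn_einf_ge_near u l : (\forall n \near \oo, l%:E <= u n) ->
  l%:E <= limn_einf u.
Proof.
move=> lu; rewrite /limn_einf leeNr -EFinN; apply: limn_esup_le_near.
by apply: filterS lu => n; rewrite EFinN leeN2.
Qed.

Lemma rate_le (N l : R) (p : \bar R) : (0 < N)%R -> 0 <= p ->
  ((N^-1)%:E * lne p <= l%:E) = (p <= (expR (N * l))%:E).
Proof.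
move=> N0 p0; rewrite lee_pdivrMl// -EFinM.
rewrite -[in LHS](expRK (N * l)%R) -lne_EFin ?expR_gt0//.
by rewrite lee_lne// in_itv/= ?p0 ?leey// lee_fin expR_ge0.
Qed.

Lemma rate_ge (N l : R) (p : \bar R) : (0 < N)%R -> 0 <= p ->
  (l%:E <= (N^-1)%:E * lne p) = ((expR (N * l))%:E <= p).
Proof.
move=> N0 p0; rewrite lee_pdivlMl// -EFinM.
rewrite -[in LHS](expRK (N * l)%R) -lne_EFin ?expR_gt0//.
by rewrite lee_lne// in_itv/= ?p0 ?leey// lee_fin expR_ge0.
Qed.

(** Testing with real c below x also covers infinite x, needed because the infimum of the rate
    function may be +oo. *)
Lemma lee_real_lt (x y : \bar R) :
  (forall c e : R, c%:E < x -> (0 < e)%R -> (c - e)%:E <= y) -> x <= y.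
Proof.
move=> H; rewrite leNgt; apply/negP => yx.
suff [c yc cx] : exists2 c : R, y < c%:E & c%:E < x.
  move: yc; apply/negP; rewrite -leNgt.
  by apply/lee_subgt0Pr => e e0; exact: H.
move: x y {H} yx => [x| |] [y| |]//=; rewrite ?lte_fin => yx.
- by exists ((x + y) / 2)%R; rewrite lte_fin; lra.
- by exists (x - 1)%R; rewrite ?lte_fin ?ltNyr//; lra.
- by exists (y + 1)%R; rewrite ?lte_fin ?ltry//; lra.
- by exists 0%R; rewrite ?ltry ?ltNyr.
Qed.

End exponential_rates.

Section change_of_reference_set.
Context d (T : measurableType d) (R : realType).
Variables (mu : {measure set T -> \bar R}) (A B E : set T) (a b r : R).
Hypotheses (mA : measurable A) (mB : measurable B) (mE : measurable E).
Hypotheses (muA : mu A = a%:E) (muB : mu B = b%:E) (a0 : (0 < a)%R).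
Hypotheses (r2 : (r <= 1 / 2)%R) (ABr : mu (A `+` B) / mu (A `|` B) <= r%:E).

Lemma conditional_measure_compare : exists x y : R,
  [/\ mu (E `&` A) = x%:E, mu (E `&` B) / mu B = y%:E,
      (y <= 2 * (x / a) + 2 * r)%R & (x / a / 2 - r <= y)%R].
Proof.
have mD : measurable (A `+` B).
  by rewrite setY_def; apply: measurableU; exact: measurableD.
have mU : measurable (A `|` B) by exact: measurableU.
have leF (F G : set T) g : measurable F -> measurable G -> F `<=` G ->
    mu G = g%:E -> exists2 f : R, mu F = f%:E & (0 <= f <= g)%R.
  move=> mF mG FG muG; have le : mu F <= g%:E.
    by rewrite -muG; apply: le_measure; rewrite ?inE.
  have fF : mu F \is a fin_num by rewrite ge0_fin_numE// (le_lt_trans le)// ltry.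
  by exists (fine (mu F)); rewrite ?fineK// fine_ge0//= -lee_fin fineK.
have [u muU] : exists u : R, mu (A `|` B) = u%:E.
  exists (fine (mu (A `|` B))); rewrite fineK// ge0_fin_numE//.
  apply: le_lt_trans (measureU2 mu mA mB) _.
  by move: muA muB => /= -> ->; rewrite -EFinD ltry.
have DU : A `+` B `<=` A `|` B.
  by rewrite setY_def => t [[]|[]]; [left|right].
have [v muD /andP[v0 _]] := leF _ _ _ mD mU DU muU.
have [_ [<-] /andP[_ au]] : exists2 f : R, a%:E = f%:E & (0 <= f <= u)%R.
  by rewrite -muA; apply: leF muU => //; exact: subsetUl.
have [_ [<-] /andP[b0 bu]] : exists2 f : R, b%:E = f%:E & (0 <= f <= u)%R.
  by rewrite -muB; apply: leF muU => //; exact: subsetUr.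
have u0 : (0 < u)%R by exact: lt_le_trans au.
have vr : (v <= r * u)%R.
  by move: ABr; rewrite muD muU inver gt_eqF// -EFinM lee_fin ler_pdivrMr.
have leU (F G : set T) f g : measurable F -> measurable G -> F `<=` G `|` (A `+` B) ->
    mu F = f%:E -> mu G = g%:E -> (f <= g + v)%R.
  move=> mF mG FG muF muG; rewrite -lee_fin EFinD -muF -muG -muD.
  apply: le_trans (measureU2 mu mG mD); apply: le_measure; rewrite ?inE//.
  exact: measurableU.
have ua : (u <= a + v)%R.
  apply: (leU _ _ _ _ mU mA _ muU muA) => t; rewrite setY_def => -[At|Bt]; first by left.
  by have [At|At] := pselect (A t); [left|right; right].
have ub : (u <= b + v)%R.
  apply: (leU _ _ _ _ mU mB _ muU muB) => t; rewrite setY_def => -[At|Bt]; last by left.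
  by have [Bt|Bt] := pselect (B t); [left|right; left].
have mEA : measurable (E `&` A) by exact: measurableI.
have mEB : measurable (E `&` B) by exact: measurableI.
have [x muEA /andP[x0 _]] := leF _ _ _ mEA mA (@subIsetr _ _ _) muA.
have [y muEB /andP[y0 _]] := leF _ _ _ mEB mB (@subIsetr _ _ _) muB.
have yx : (y <= x + v)%R.
  apply: (leU _ _ _ _ mEB mEA _ muEB muEA) => t [Et Bt]; rewrite setY_def.
  by have [At|At] := pselect (A t); [left|right; right].
have xy : (x <= y + v)%R.
  apply: (leU _ _ _ _ mEA mEB _ muEA muEB) => t [Et At]; rewrite setY_def.
  by have [Bt|Bt] := pselect (B t); [left|right; left].
have ru : (r * u <= u / 2)%R by have := ler_wpM2r (ltW u0) r2; lra.
have b_gt0 : (0 < b)%R by lra.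
exists x, (y / b)%R; split => //.
- by rewrite muEB muB inver gt_eqF// -EFinM.
- rewrite ler_pdivrMr//.
  have xa : (x <= x / a * u)%R by rewrite mulrAC ler_pdivlMr// ler_wpM2l.
  have r0 : (0 <= r)%R.
    by rewrite -(pmulr_lge0 _ u0) (le_trans v0).
  have q0 : (0 <= 2 * (x / a) + 2 * r)%R.
    by rewrite addr_ge0 ?mulr_ge0 ?invr_ge0// ltW.
  have ub2 : (u / 2 <= b)%R by lra.
  apply: le_trans (ler_wpM2l q0 ub2).
  by lra.
- rewrite ler_pdivlMr//.
  have xa : (x / a / 2 * u <= x)%R.
    rewrite (_ : x / a / 2 * u = x * (u / 2 / a))%R; last by ring.
    by rewrite ler_piMr// ler_pdivrMr// mul1r; lra.
  have [neg|pos] := leP (x / a / 2 - r)%R 0%R.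
    by rewrite (le_trans (mulr_le0_ge0 neg b0)).
  apply: le_trans (ler_wpM2l (ltW pos) bu) _.
  by rewrite mulrBl; lra.
Qed.

End change_of_reference_set.

Section transfer.
Context (R : realType) (V : nat -> R -> R) (Vbar : R -> R).
Hypotheses (oV : forall i, orlicz (EFin \o V i)) (oW : orlicz (EFin \o Vbar)).
Hypothesis sW : superquadratic (EFin \o Vbar).
Hypothesis volume_asymp :
  (n.+1%:R^-1)%:E *
    lne (lebesgue_n R n.+1
           (orlicz_ball n.+1 (fun=> Vbar) `+` orlicz_ball n.+1 V) /
         lebesgue_n R n.+1
           (orlicz_ball n.+1 (fun=> Vbar) `|` orlicz_ball n.+1 V))
  @[n --> \oo] --> -oo.
Context (d : nat -> measure_display) (T : forall n, measurableType (d n))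
  (P : forall n, probability (T n) R) (X : forall n, {RV (P n) >-> Rn R n.+1}).
Hypothesis uniform_X : forall n, uniform_on (X n) (orlicz_ball n.+1 V).
Local Notation Rp := (set_type (@Rplus R)).
Local Notation J0 := (volume_rate Vbar).

Local Notation B n := (orlicz_ball n (fun=> Vbar)).
Local Notation BV n := (orlicz_ball n V).
Let mB n : measurable (B n). Proof. exact: measurable_orlicz_ball. Qed.
Let mBV n : measurable (BV n). Proof. exact: measurable_orlicz_ball. Qed.

(* No random variable is uniform on a set of infinite volume, because
   [+oo / +oo = 0] in [\bar R]. *)
Lemma orlicz_ball_volume_fin n :
  exists b : R, lebesgue_n R n.+1 (orlicz_ball n.+1 V) = b%:E.
Proof.
have := @uniform_X n setT measurableT.
rewrite preimage_setT probability_setT setTI.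
have := measure_ge0 (lebesgue_n R n.+1) (orlicz_ball n.+1 V).
case: (lebesgue_n R n.+1 (orlicz_ball n.+1 V)) => [b| |]//.
  by exists b.
by move=> _; rewrite invey mule0 => /eqP; rewrite onee_eq0.
Qed.

(** Superexponential closeness allows r = e^(-(n + 1) M) for any [M]; M >= 1 ensures r <= 1/2. The
    threshold on n does not depend on [G]. *)
Lemma uniform_compare (M : R) : (1 <= M)%R -> \forall n \near \oo,
  forall G : set Rp, borel G -> exists a x y : R,
  [/\ (0 < a)%R, lebesgue_n R n.+1 (B n.+1) = a%:E,
     lebesgue_n R n.+1 (@scaled_norm R n.+1 @^-1` G `&` B n.+1) = x%:E,
     P n ((fun w => scaled_norm (X n w)) @^-1` G) = y%:E &
     (x / a / 2 - expR (- (n.+1%:R * M)) <= y <=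
       2 * (x / a) + 2 * expR (- (n.+1%:R * M)))%R].
Proof.
move=> M1.
have volM := cvgeNy_le volume_asymp (- M).
have [N _ NP] := orlicz_ball_volume_ge oW sW (@ltr01 R).
near=> n => G bG.
have n0 : (0 < n.+1%:R :> R)%R by [].
have [b bE] := orlicz_ball_volume_fin n.
have [a aE] : exists a : R, lebesgue_n R n.+1 (B n.+1) = a%:E.
  exists (fine (lebesgue_n R n.+1 (B n.+1))); rewrite fineK// ge0_fin_numE//.
  by rewrite (le_lt_trans (orlicz_ball_volume_le oW sW n (@ltr01 R)))// ltry.
have a0 : (0 < a)%R.
  rewrite -lte_fin -aE; apply: lt_le_trans (NP n.+1 _).
    by rewrite lte_fin expR_gt0.
  by apply: leqW; near: n; exists N.
have r2 : (expR (- (n.+1%:R * M)) <= 1 / 2 :> R)%R.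
  have e2 : (2 <= expR 1 :> R)%R by have := expR_ge1Dx (1 : R); lra.
  have eM : (expR 1 <= expR (n.+1%:R * M) :> R)%R.
    by rewrite ler_expR -[leLHS]mulr1 ler_pM// ler1n.
  by rewrite expRN div1r lef_pV2 ?posrE ?expR_gt0// (le_trans e2).
have Dr : lebesgue_n R n.+1 (B n.+1 `+` BV n.+1) /
    lebesgue_n R n.+1 (B n.+1 `|` BV n.+1) <= (expR (- (n.+1%:R * M)))%:E.
  rewrite -mulrN -rate_le ?mule_ge0 ?inve_ge0//.
  by near: n; exact: volM.
have mE : measurable (@scaled_norm R n.+1 @^-1` G) by exact: measurable_scaled_norm.
have [x [y [xE yE yx xy]]] :=
  conditional_measure_compare (@mB n.+1) (@mBV n.+1) mE aE bE a0 r2 Dr.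
exists a, x, y; split => //; last by rewrite xy.
by rewrite -yE -uniform_X.
Unshelve. all: by end_near. Qed.

Lemma scaled_norm_LDP_lower (G : set Rp) : borel G ->
  - ereal_inf (JX Vbar @` G°) <=
  limn_einf (fun n => (n.+1%:R^-1)%:E *
    lne (P n ((fun w => scaled_norm (X n w)) @^-1` G))).
Proof.
move=> bG; rewrite leeNl; apply: le_ereal_inf_tmp => _ [z zG <-].
have := JX_ge0 oW sW z.
case Jz : (JX Vbar z) => [j| |]// j0; last by rewrite leey.
rewrite leeNl -EFinN; apply/lee_subgt0Pr => e e0.
rewrite -EFinB; apply: limn_einf_ge_near.
have e3 : (0 < e / 3)%R by rewrite divr_gt0.
have jz : calJ Vbar 1 (set_val z ^+ 2) <= (j + J0)%:E.
  by apply/(JX_le oW sW); rewrite Jz.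
have low := orlicz_ball_open_ge oW sW bG zG e3 jz.
(* The volumes of the slice and of the ball each lose e / 3, so x / a has rate j + 2 e / 3; one unit
   more makes the comparison error negligible. The last e / 3 absorbs the factor 1/4. *)
have j1 : (1 <= j + 2 * (e / 3) + 1)%R by rewrite lee_fin in j0; lra.
have cmp := uniform_compare j1.
have [N1 _ N1P] := @near_expRN_le R 1 (1 / 4) ltr01 ltac:(lra).
have [N2 _ N2P] := @near_expRN_le R (e / 3) (1 / 4) e3 ltac:(lra).
near=> n.
have Nn1 : (N1 <= n)%N by near: n; exists N1.
have Nn2 : (N2 <= n)%N by near: n; exists N2.
have [a [x [y [a0 aE xE yE /andP[xy _]]]]] : exists a x y : R,
  [/\ (0 < a)%R, lebesgue_n R n.+1 (B n.+1) = a%:E,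
     lebesgue_n R n.+1 (@scaled_norm R n.+1 @^-1` G `&` B n.+1) = x%:E,
     P n ((fun w => scaled_norm (X n w)) @^-1` G) = y%:E &
     (x / a / 2 - expR (- (n.+1%:R * (j + 2 * (e / 3) + 1))) <= y <=
       2 * (x / a) + 2 * expR (- (n.+1%:R * (j + 2 * (e / 3) + 1))))%R].
  by near: n; apply: filterS cmp => n /(_ G bG).
have xlow : (expR (- (n.+1%:R * (j + J0 + e / 3))) <= x)%R.
  by rewrite -lee_fin -xE; near: n.
have aup : (a <= expR (- (n.+1%:R * (J0 - e / 3))))%R.
  by rewrite -lee_fin -aE orlicz_ball_volume_le.
rewrite rate_ge// yE lee_fin; apply: le_trans xy.
have xa : (expR (- (n.+1%:R * (j + 2 * (e / 3)))) <= x / a)%R.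
  rewrite ler_pdivlMr//; apply: le_trans xlow.
  apply: le_trans (ler_wpM2l (expR_ge0 _) aup) _.
  by rewrite -expRD ler_expR; lra.
have := N1P n.+1 (leqW Nn1); have := N2P n.+1 (leqW Nn2).
rewrite mulr1 => e2 e1.
set q := expR (- (n.+1%:R * (j + 2 * (e / 3)))).
have q0 : (0 < q)%R by exact: expR_gt0.
have -> : expR (- (n.+1%:R * (j + 2 * (e / 3) + 1))) = (q * expR (- n.+1%:R))%R.
  by rewrite -expRD; congr expR; ring.
have -> : expR (n.+1%:R * (- j - e)) = (q * expR (- (n.+1%:R * (e / 3))))%R.
  by rewrite -expRD; congr expR; field.
have := ler_wpM2l (ltW q0) e1; have := ler_wpM2l (ltW q0) e2.
by move: xa; rewrite -/q; lra.
Unshelve. all: by end_near. Qed.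

Lemma scaled_norm_LDP_upper (G : set Rp) : borel G ->
  limn_esup (fun n => (n.+1%:R^-1)%:E *
    lne (P n ((fun w => scaled_norm (X n w)) @^-1` G))) <=
  - ereal_inf (JX Vbar @` closure G).
Proof.
move=> bG; rewrite leeNr; apply: lee_real_lt => c e cJ e0.
rewrite leeNr -EFinN; apply: limn_esup_le_near.
have [|K KP] := @orlicz_ball_closed_le R Vbar oW sW G (c + J0) bG.
  move=> z zG; apply/(JX_gt oW sW); apply: lt_le_trans cJ _.
  by apply: ereal_inf_lbound; exists z.
have e2 : (0 < e / 2)%R by rewrite divr_gt0.
have cM : (1 <= `|c| + 1)%R by rewrite lerDr.
have cmp := uniform_compare cM.
(* Total prefactor: x / a contributes 2 |K| and the comparison error 2, since its rate |c| + 1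
   exceeds c - e / 2. The remaining e / 2 absorbs it. *)
pose K2 := (2 * `|K| + 2)%R.
have K20 : (0 < K2)%R by rewrite /K2 ltr_wpDl ?mulr_ge0.
have [N1 _ N1P] := @near_expRN_le R (e / 2) (K2^-1) e2 ltac:(by rewrite invr_gt0).
have [N2 _ N2P] := orlicz_ball_volume_ge oW sW e2.
near=> n.
have Nn1 : (N1 <= n)%N by near: n; exists N1.
have Nn2 : (N2 <= n)%N by near: n; exists N2.
have [a [x [y [a0 aE xE yE /andP[_ xy]]]]] : exists a x y : R,
  [/\ (0 < a)%R, lebesgue_n R n.+1 (B n.+1) = a%:E,
     lebesgue_n R n.+1 (@scaled_norm R n.+1 @^-1` G `&` B n.+1) = x%:E,
     P n ((fun w => scaled_norm (X n w)) @^-1` G) = y%:E &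
     (x / a / 2 - expR (- (n.+1%:R * (`|c| + 1))) <= y <=
       2 * (x / a) + 2 * expR (- (n.+1%:R * (`|c| + 1))))%R].
  by near: n; apply: filterS cmp => n /(_ G bG).
have n0 : (0 < n.+1%:R :> R)%R by [].
have xup : (x <= `|K| * expR (- (n.+1%:R * (c + J0))))%R.
  rewrite -lee_fin -xE; apply: le_trans (KP n) _.
  by rewrite lee_fin ler_wpM2r ?expR_ge0// ler_norm.
have alow : (expR (- (n.+1%:R * (J0 + e / 2))) <= a)%R.
  by rewrite -lee_fin -aE; apply: N2P; exact: leqW.
rewrite rate_le// yE lee_fin; apply: (le_trans xy).
set q := expR (- (n.+1%:R * (c - e / 2))).
have q0 : (0 < q)%R by exact: expR_gt0.
have xa : (x / a <= `|K| * q)%R.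
  rewrite ler_pdivrMr//; apply: (le_trans xup).
  rewrite -mulrA ler_wpM2l//.
  apply: le_trans (ler_wpM2l (ltW q0) alow).
  by rewrite -expRD ler_expR; lra.
have rq : (expR (- (n.+1%:R * (`|c| + 1))) <= q)%R.
  by rewrite ler_expR lerN2 ler_wpM2l ?(ltW n0)//; have := ler_norm c; lra.
have -> : expR (n.+1%:R * - (c - e)) = (q * (expR (- (n.+1%:R * (e / 2))))^-1)%R.
  by rewrite -expRN -expRD; congr expR; field.
have K2e : (K2 <= (expR (- (n.+1%:R * (e / 2))))^-1)%R.
  rewrite -[leLHS]invrK lef_pV2 ?posrE ?invr_gt0 ?expR_gt0//.
  by apply: N1P; exact: leqW.
apply: le_trans (ler_wpM2l (ltW q0) K2e).
by rewrite /K2; lra.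
Unshelve. all: by end_near. Qed.

End transfer.

(* The index n : nat stands for the dimension n + 1, and the coordinate
   functions are numbered from 0. *)
Theorem lemma3p16 (R : realType) (V : nat -> R -> R) (Vbar : R -> R) (cV : R)
    (orlicz_V : forall i, orlicz (EFin \o V i))
    (superquadratic_V : forall i, superquadratic (EFin \o V i))
    (orlicz_Vbar : orlicz (EFin \o Vbar))
    (superquadratic_Vbar : superquadratic (EFin \o Vbar))
    (cV_gt0 : (0 < cV)%R)
    (uniform_V : forall x : R, (cV < x)%R ->
      (forall i, (x ^+ 2 < V i x)%R) /\ (x ^+ 2 < Vbar x)%R)
    (volume_asymp :
      (n.+1%:R^-1)%:E *
        lne (lebesgue_n R n.+1
               (orlicz_ball n.+1 (fun=> Vbar) `+` orlicz_ball n.+1 V) /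
             lebesgue_n R n.+1
               (orlicz_ball n.+1 (fun=> Vbar) `|` orlicz_ball n.+1 V))
      @[n --> \oo] --> -oo)
    (d : nat -> measure_display) (T : forall n, measurableType (d n))
    (P : forall n, probability (T n) R)
    (X : forall n, {RV (P n) >-> Rn R n.+1})
    (uniform_X : forall n, uniform_on (X n) (orlicz_ball n.+1 V)) :
  LDP P (fun n w => scaled_norm (X n w)) (fun n => n.+1%:R) (JX Vbar) /\
  good_rate_function (JX Vbar).
Proof.
have goodJ := JX_good_rate_function orlicz_Vbar superquadratic_Vbar.
split => //; split.
- exact: Rplus_regular.
- move=> n G bG.
  rewrite (_ : _ @^-1` G = X n @^-1` (@scaled_norm R n.+1 @^-1` G))//.
  rewrite -[X in measurable X]setTI; apply: measurable_funPT => //.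
  exact: measurable_scaled_norm.
- split=> [n|]; first exact: ltr0Sn.
  apply/cvgryPge => A; apply: filterS (nbhs_infty_ger A) => n /le_trans; apply.
  by rewrite ler_nat.
- by case: goodJ.
- move=> G bG /=; split; last first.
  + exact: scaled_norm_LDP_upper.
  + exact: limn_einf_sup.
  + exact: scaled_norm_LDP_lower.
Qed.
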